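(* Let $E$ be a pseudo effect algebra satisfying (RDP) with $\mathcal S(E)\neq\emptyset$, and let $s\in\mathcal S(E)$. Then there is a unique regular Borel probability measure $\mu_s$ on $\mathcal B(\mathcal S(E))$ that is maximal in the Choquet ordering and satisfies $\mu_s\sim\delta_s$, and $$s(a)=\int_{\mathcal S(E)}\hat a(x)\,d\mu_s(x)\quad\text{for all }a\in E,$$ where $\hat a(x)=x(a)$ for $x\in\mathcal S(E)$.
   Context: Pseudo effect algebra: partial algebra $(E;+,0,1)$ such that for all $a,b,c$: (i) $a+b$ and $(a+b)+c$ exist iff $b+c$ and $a+(b+c)$ exist, and then they are equal; (ii) there is exactly one $d$ and one $e$ with $a+d=e+a=1$; (iii) if $a+b$ exists there are $d,e$ with $a+b=d+a=b+e$; (iv) if $1+a$ or $a+1$ exists then $a=0$. (RDP): whenever $a_1+a_2=b_1+b_2$ there are $d_1,\dots,d_4$ with $d_1+d_2=a_1$, $d_3+d_4=a_2$, $d_1+d_3=b_1$, $d_2+d_4=b_2$. A state on $E$ is a map $s:E\to[0,\infty)$ additive on defined sums with $s(1)=1$; $\mathcal S(E)$ is the set of states, a compact convex set in the topology of pointwise convergence. $\mathcal B(K)$ is the Borel $\sigma$-algebra of $K$; $\delta_s$ is the Dirac measure at $s$. For a compact convex $K$, $\mathrm{Aff}(K)$ denotes continuous affine real functions and $\mathrm{Con}(K)$ continuous convex real functions on $K$. For nonnegative regular Borel measures: $\mu\sim\lambda$ iff $\int f\,d\mu=\int f\,d\lambda$ for all $f\in\mathrm{Aff}(K)$; the Choquet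 ordering is $\mu\prec\lambda$ iff $\int f\,d\mu\le\int f\,d\lambda$ for all $f\in\mathrm{Con}(K)$; maximal means maximal with respect to $\prec$. *)

(* Defs.v *)
From HB Require Import structures.
From mathcomp Require Import all_boot all_order all_algebra.
From mathcomp Require Import all_classical all_reals all_analysis.
Set Implicit Arguments. Unset Strict Implicit. Unset Printing Implicit Defensive.
Import Order.TTheory GRing.Theory Num.Theory.
Import numFieldNormedType.Exports.
Local Open Scope classical_set_scope.
Local Open Scope ring_scope.

Section PEA.
Variables (E : Type) (plus : E -> E -> option E) (zero one : E).

Definition padd (x y : option E) : option E :=
  match x, y with Some a, Some b => plus a b | _, _ => None end.

Definition pseudo_effect_algebra : Prop :=
  [/\
      (forall a b c, padd (plus a b) (Some c) = padd (Some a) (plus b c)),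
      (forall a, (exists! d, plus a d = Some one) /\ (exists! e, plus e a = Some one)),
      (forall a b c, plus a b = Some c ->
         exists d e, plus d a = Some c /\ plus b e = Some c)
    &
      (forall a, (plus one a <> None \/ plus a one <> None) -> a = zero)].

Definition RDP : Prop :=
  forall a1 a2 b1 b2 c, plus a1 a2 = Some c -> plus b1 b2 = Some c ->
  exists d1 d2 d3 d4,
    [/\ plus d1 d2 = Some a1, plus d3 d4 = Some a2,
        plus d1 d3 = Some b1 & plus d2 d4 = Some b2].

End PEA.

Section States.
Variables (R : realType) (E : Type) (plus : E -> E -> option E) (one : E).

Definition is_state (s : E -> R) : Prop :=
  [/\ (forall a, 0 <= s a),
      (forall a b c, plus a b = Some c -> s c = s a + s b)
    & s one = 1].

Definition state_set : set {ptws E -> R} := [set s | is_state s].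

(** The state space as a type (the subtype topology is the initial topology of
    the inclusion); the alias is pointed by a given state [s0] (needed by
    mathcomp's measurable types; the point plays no other role). *)
Definition state_pt (s0 : state_set) : Type := set_type state_set.
HB.instance Definition _ (s0 : state_set) :=
  Topological.copy (state_pt s0) (set_type state_set).
HB.instance Definition _ (s0 : state_set) :=
  isPointed.Build (state_pt s0) s0.

Definition borel_states (s0 : state_set) :=
  g_sigma_algebraType (@open (state_pt s0)).

End States.

Section Choquet.
Variables (R : realType) (E : Type) (plus : E -> E -> option E) (one : E).
Variable (s0 : @state_set R E plus one).
Local Notation K := (state_pt s0).
Local Notation BK := (borel_states s0).

Definition affine_on (f : K -> R) : Prop :=
  forall (x y z : K) (t : R), 0 <= t <= 1 ->
    (forall a, set_val z a = t * set_val x a + (1 - t) * set_val y a) ->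
    f z = t * f x + (1 - t) * f y.

Definition convex_on (f : K -> R) : Prop :=
  forall (x y z : K) (t : R), 0 <= t <= 1 ->
    (forall a, set_val z a = t * set_val x a + (1 - t) * set_val y a) ->
    f z <= t * f x + (1 - t) * f y.

Definition Aff (f : K -> R) : Prop := continuous f /\ affine_on f.
Definition Con (f : K -> R) : Prop := continuous f /\ convex_on f.

Definition regular_measure (mu : {measure set BK -> \bar R}) : Prop :=
  (mu setT < +oo)%E /\
  forall A : set BK, measurable A ->
    mu A = ereal_sup [set mu C | C in [set C : set K | compact C /\ C `<=` A]] /\
    mu A = ereal_inf [set mu U | U in [set U : set K | open U /\ A `<=` U]].

Definition meas_equiv (mu la : set BK -> \bar R) : Prop :=
  forall f : K -> R, Aff f ->
    (\int[mu]_x (f x)%:E = \int[la]_x (f x)%:E)%E.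

Definition choquet_le (mu la : set BK -> \bar R) : Prop :=
  forall f : K -> R, Con f ->
    (\int[mu]_x (f x)%:E <= \int[la]_x (f x)%:E)%E.

Definition choquet_maximal (mu : {measure set BK -> \bar R}) : Prop :=
  regular_measure mu /\
  forall la : {measure set BK -> \bar R}, regular_measure la ->
    choquet_le mu la -> forall A : set BK, measurable A -> la A = mu A.

End Choquet.

(* Main.v *)
(** Let [K] be the state space. For convex continuous [f], let [env s f] be the
    supremum of [sum c_i f (x_i)] over the finite convex decompositions
    [s = sum c_i x_i] in [K], each term [c_i x_i] being an additive map [E -> R].
    By (RDP) the additive maps have meets, so that two decompositions of [s] have
    a common refinement, and refining increases the sum for every convex [f] at
    once. Hence [env s] is additive on convex functions, and
    [f - g |-> env s f - env s g] is a positive linear functional on differences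
    of convex continuous functions. These form a vector lattice which contains the
    constants and separates points, so a Riesz representation for such lattices
    gives a regular measure [mu] with [int f dmu = env s f] for [f] convex.
    Conversely, cutting [K] into small pieces and replacing each by its barycenter
    shows that [int f dla <= env s f] for every measure [la] with barycenter [s].
    So [mu] dominates every such [la] in the Choquet order, which gives both
    its maximality and its uniqueness. *)
Require Import Defs.
From HB Require Import structures.
From mathcomp Require Import all_boot all_order all_algebra.
From mathcomp Require Import all_classical all_reals all_analysis.
From mathcomp Require Import measurable_realfun lra.
Import Order.TTheory GRing.Theory Num.Theory.
Import numFieldNormedType.Exports.
Local Open Scope classical_set_scope.
Local Open Scope ring_scope.
Set Implicit Arguments.
Unset Strict Implicit.

(** * Compactness and vector lattices of continuous functions *)

(* Otherwise the sets whose complement in [K] fails [P] would form a proper filter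
   without cluster point. *)
Lemma compact_ind (T : topologicalType) (K : set T) (P : set T -> Prop) :
  compact K -> P set0 -> (forall A B, A `<=` B -> P B -> P A) ->
  (forall A B, P A -> P B -> P (A `|` B)) ->
  (forall x, K x -> exists2 U, nbhs x U & P U) -> P K.
Proof.
move=> cK P0 Psub PU Ploc; apply: contrapT => nPK.
pose F : set_system T := [set B | P (K `\` B)].
have FF : ProperFilter F.
  apply: Build_ProperFilter; first by rewrite /F /= setD0.
  split.
  - by rewrite /F /= setDT.
  - by move=> A B FA FB; rewrite /F /= setDIr; exact: PU.
  - by move=> A B AB; apply: Psub; exact: setDS.
have [|x [Kx clx]] := cK F FF; first by rewrite /F /= setDv.
have [U nU PUx] := Ploc x Kx.
have [|y [/= nUy Uy]] := clx (~` U) U _ nU; last by [].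
by rewrite /F /= setDE setCK; apply: Psub PUx => z [].
Qed.

(** Closure under absolute values encodes the lattice operations, since [max f g] is half of
    [f + g + |f - g|]. *)
Definition vector_lattice (R : realType) (T : Type) (V : set (T -> R)) :=
  [/\ V (fun=> 1),
      (forall f g, V f -> V g -> V (fun x => f x + g x)),
      (forall c f, V f -> V (fun x => c * f x))
    & (forall f, V f -> V (fun x => `|f x|))].

Section VectorLattice.
Variables (R : realType) (T : Type) (V : set (T -> R)).
Hypothesis latV : vector_lattice V.

Lemma lattD f g : V f -> V g -> V (fun x => f x + g x).
Proof. by case: latV => _ + _ _; exact. Qed.

Lemma lattZ c f : V f -> V (fun x => c * f x).
Proof. by case: latV => _ _ + _; exact. Qed.

Lemma latt_cst c : V (fun=> c).
Proof.
case: latV => V1 _ VZ _; rewrite (_ : (fun=> c) = fun x : T => c * 1).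
  exact: (VZ c (fun=> 1)).
by apply/funext => x; rewrite mulr1.
Qed.

Lemma lattN f : V f -> V (fun x => - f x).
Proof.
move=> Vf; rewrite (_ : (fun _ => _) = fun x => (-1) * f x).
  exact: lattZ.
by apply/funext => x; rewrite mulN1r.
Qed.

Lemma lattB f g : V f -> V g -> V (fun x => f x - g x).
Proof. by move=> Vf Vg; apply: lattD => //; exact: lattN. Qed.

Lemma latt_max f g : V f -> V g -> V (fun x => Num.max (f x) (g x)).
Proof.
move=> Vf Vg; rewrite (_ : (fun _ => _) =
  fun x => 2^-1 * (f x + g x + `|f x - g x|)).
  apply/lattZ/lattD; first exact: lattD.
  by case: latV => _ _ _; apply; exact: lattB.
by apply/funext => x; rewrite maxr_absE mulrC.
Qed.

Lemma latt_min f g : V f -> V g -> V (fun x => Num.min (f x) (g x)).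
Proof.
move=> Vf Vg; rewrite (_ : (fun _ => _) =
  fun x => - Num.max (- f x) (- g x)).
  by apply/lattN/latt_max; exact: lattN.
by apply/funext => x; rewrite -oppr_min opprK.
Qed.

Variable L : (T -> R) -> R.
(** [L] is a total function on [T -> R], constrained only on [V]. *)
Definition positive_linear :=
  [/\ (forall f g, V f -> V g -> L (fun x => f x + g x) = L f + L g),
      (forall c f, V f -> L (fun x => c * f x) = c * L f)
    & (forall f, V f -> (forall x, 0 <= f x) -> 0 <= L f)].
Hypothesis linL : positive_linear.

Lemma poslinD f g : V f -> V g -> L (fun x => f x + g x) = L f + L g.
Proof. by case: linL => + _ _; exact. Qed.

Lemma poslinZ c f : V f -> L (fun x => c * f x) = c * L f.
Proof. by case: linL => _ + _; exact. Qed.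

Lemma poslin_cst c : L (fun=> c) = c * L (fun=> 1).
Proof.
rewrite -poslinZ; last exact: latt_cst.
by congr L; apply/funext => x; rewrite mulr1.
Qed.

Lemma poslinB f g : V f -> V g -> L (fun x => f x - g x) = L f - L g.
Proof.
move=> Vf Vg; rewrite (poslinD Vf (lattN Vg)); congr (_ + _).
rewrite -mulN1r -poslinZ//.
by congr L; apply/funext => x; rewrite mulN1r.
Qed.

Lemma le_poslin f g : V f -> V g -> (forall x, f x <= g x) -> L f <= L g.
Proof.
move=> Vf Vg fg; rewrite -subr_ge0 -poslinB//.
case: linL => _ _; apply; first exact: lattB.
by move=> x; rewrite subr_ge0.
Qed.

End VectorLattice.

(** * Separation of points and closed sets by a lattice of continuous functions *)

Section Separation.
Variables (R : realType) (T : topologicalType) (V : set (T -> R)).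
Hypotheses (latV : vector_lattice V) (ctsV : forall f, V f -> continuous f)
  (sepV : forall x y, x <> y -> exists2 f, V f & f x <> f y)
  (cT : compact [set: T]).

Lemma separating_hausdorff : hausdorff_space T.
Proof.
move=> x y clxy; apply: contrapT => /sepV[f Vf]; apply.
apply: (@norm_hausdorff _ R^o) => A B nA nB.
have [z [Az Bz]] := clxy _ _ (ctsV Vf nA) (ctsV Vf nB).
by exists (f z).
Qed.

Lemma open_ltr_fun f c : continuous f -> open [set x : T | f x < c :> R].
Proof. by move=> /continuousP cf; apply: (cf [set y | y < c]); exact: open_lt. Qed.

Lemma open_gtr_fun f c : continuous f -> open [set x : T | c < f x :> R].
Proof. by move=> /continuousP cf; apply: (cf [set y | c < y]); exact: open_gt. Qed.

Lemma closed_ler_fun f c : continuous f -> closed [set x : T | c <= f x :> R].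
Proof.
move=> cf; rewrite (_ : mkset _ = ~` [set x | f x < c]).
  by apply: open_closedC; exact: open_ltr_fun.
by apply/seteqP; split=> x /=; rewrite leNgt => /negP.
Qed.

(** Near each [y] in [D] a rescaled function separating [x] from [y] is negative; by compactness of
    [D] the minimum of finitely many of them works on all of [D]. *)
Lemma lattice_separate_point x D : closed D -> ~ D x ->
  exists2 h, V h & h x = 2 /\ forall y, D y -> h y < 0.
Proof.
move=> clD nDx.
(* One copy of [D] stays fixed, while the other is replaced by the sets through which the
   compactness induction runs. *)
suff : exists2 h, V h & h x = 2 /\ forall y, (D `&` D) y -> h y < 0.
  by rewrite setIid.
have cD : compact D by apply: (subclosed_compact clD cT).
apply: (compact_ind (P := fun A => exists2 h, V h & h x = 2 /\
  forall y, (A `&` D) y -> h y < 0) cD).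
- by exists (fun=> 2); [exact: latt_cst|split=> // y []].
- move=> A B AB [h Vh [hx hB]]; exists h => //; split=> // y [/AB By Dy]; exact: hB.
- move=> A B [f Vf [fx fA]] [g Vg [gx gB]].
  exists (fun y => Num.min (f y) (g y)); first exact: latt_min.
  rewrite fx gx minxx; split=> // y [[Ay|By] Dy].
    by rewrite gt_min fA.
  by rewrite gt_min gB ?orbT.
- move=> y Dy.
  have [f Vf fxy] : exists2 f, V f & f x <> f y.
    by apply: sepV => xy; apply: nDx; rewrite xy.
  (* The affine rescaling of [f] with value [2] at [x] and [-1] at [y]. *)
  pose h z := 2 + - (3 / (f x - f y)) * (f x - f z).
  have Vh : V h.
    apply: (lattD latV); first exact: latt_cst.
    by apply/(lattZ latV)/(lattB latV) => //; exact: latt_cst.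
  have fxy0 : f x - f y != 0 by rewrite subr_eq0; exact/eqP.
  exists [set z | h z < 0].
    apply: open_nbhs_nbhs; split; first exact/open_ltr_fun/ctsV.
    by rewrite /= /h mulNr divfK//; lra.
  by exists h => //; split; [rewrite /h subrr mulr0 addr0|move=> z []].
Qed.

(** A Urysohn lemma inside [V]: maxima of functions separating the points of [C] from [D] exceed [1]
    on [C] and are negative on [D], and truncation to the unit interval finishes. *)
Lemma lattice_separate C D : closed C -> closed D -> C `&` D = set0 ->
  exists2 h, V h & [/\ (forall x, 0 <= h x <= 1), (forall x, C x -> h x = 1) &
                       (forall x, D x -> h x = 0)].
Proof.
move=> clC clD CD0.
have cC : compact C by apply: (subclosed_compact clC cT).
have [h Vh [hC hD]] : exists2 h, V h & (forall x, (C `&` C) x -> 1 < h x) /\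
    (forall x, D x -> h x < 0).
  apply: (compact_ind (P := fun A => exists2 h, V h &
     (forall x, (A `&` C) x -> 1 < h x) /\ (forall x, D x -> h x < 0)) cC).
  - by exists (fun=> -1); [exact: latt_cst|split => x; [case|rewrite ltrN10]].
  - move=> A B AB [h Vh [hB hD]]; exists h => //; split=> // y [/AB By Cy].
    exact: hB.
  - move=> A B [f Vf [fA fD]] [g Vg [gB gD]].
    exists (fun y => Num.max (f y) (g y)); first exact: latt_max.
    split=> y; last by move=> Dy; rewrite gt_max fD// gD.
    by move=> [[Ay|By] Cy]; rewrite lt_max; [rewrite fA|rewrite gB ?orbT].
  - move=> x Cx; have nDx : ~ D x by move=> Dx; rewrite -[False]/(set0 x) -CD0.
    have [h Vh [hx hD]] := lattice_separate_point clD nDx.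
    exists [set z | 1 < h z]; last by exists h => //; split => // z [].
    apply: open_nbhs_nbhs; split; first exact/open_gtr_fun/ctsV.
    by rewrite /= hx ltr1n.
exists (fun x => Num.min (Num.max (h x) 0) 1).
  by apply: latt_min (latt_cst _ 1) => //; apply: latt_max (latt_cst _ 0).
split=> x; first by rewrite le_min ge_min le_max !lexx ler01 !orbT.
  by move=> Cx; apply/min_idPr; rewrite le_max ltW// hC.
by move=> Dx; rewrite (max_idPr (ltW (hD _ Dx))) (min_idPl ler01).
Qed.

End Separation.

(** * Riesz representation on a vector lattice *)

(** The scale [c] of the error may vanish; it is often the total mass [L (fun=> 1)]. *)
Lemma ler_addeps (R : realFieldType) (a b c : R) : 0 <= c ->
  (forall e, 0 < e -> a <= b + e * c) -> a <= b.
Proof.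
rewrite le_eqVlt => /predU1P[<- /(_ 1 ltr01)|c0 abc].
  by rewrite mulr0 addr0.
apply/ler_addgt0Pr => e e0; have := abc (e / c) (divr_gt0 e0 c0).
by rewrite divfK// gt_eqF.
Qed.

(** * Inner and outer volumes induced by a positive functional *)

Section InnerVolume.
Variables (R : realType) (T : topologicalType) (V : set (T -> R)).
Variable L : (T -> R) -> R.
Hypotheses (latV : vector_lattice V) (ctsV : forall f, V f -> continuous f)
  (sepV : forall x y, x <> y -> exists2 f, V f & f x <> f y)
  (cT : compact [set: T]) (linL : positive_linear V L).

(** Vanishing off [U] replaces the usual condition on supports; the closed sets where [e <= h x]
    take over the role of the supports. *)
Definition below (U : set T) : set (T -> R) :=
  [set h | [/\ V h, (forall x, 0 <= h x <= 1) & (forall x, ~ U x -> h x = 0)]].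

Definition inner_vol (U : set T) : R := sup (L @` below U).

Definition outer_vol (A : set T) : R :=
  inf [set inner_vol U | U in [set U | open U /\ A `<=` U]].

Lemma below0 U : below U (fun=> 0).
Proof. by split=> // [|x]; [exact: latt_cst|rewrite lexx ler01]. Qed.

Lemma poslin1_ge0 : 0 <= L (fun=> 1).
Proof. by case: linL => _ _; apply=> [|x]; [exact: latt_cst|exact: ler01]. Qed.

Lemma has_ubound_below U : has_ubound (L @` below U).
Proof.
exists (L (fun=> 1)) => _ [h [Vh h01 _] <-].
apply: (le_poslin latV linL) => //; first exact: latt_cst.
by move=> x; case/andP: (h01 x).
Qed.

Lemma le_inner_vol U h : below U h -> L h <= inner_vol U.
Proof.
by move=> Uh; apply: ub_le_sup; [exact: has_ubound_below|exists h].
Qed.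

Lemma inner_vol_le U c : (forall h, below U h -> L h <= c) -> inner_vol U <= c.
Proof.
move=> Uc; apply: ge_sup; first by exists (L (fun=> 0)), (fun=> 0); first exact: below0.
by move=> _ [h Uh <-]; exact: Uc.
Qed.

Lemma inner_vol_ge0 U : 0 <= inner_vol U.
Proof.
apply: le_trans (le_inner_vol (below0 U)).
by rewrite (poslin_cst latV linL) mul0r.
Qed.

Lemma inner_vol_mono U W : U `<=` W -> inner_vol U <= inner_vol W.
Proof.
move=> UW; apply: inner_vol_le => h [Vh h01 h0]; apply: le_inner_vol.
by split=> // x nWx; apply: h0 => /UW.
Qed.

Lemma inner_volT : inner_vol setT = L (fun=> 1).
Proof.
apply/eqP; rewrite eq_le; apply/andP; split.
  apply: inner_vol_le => h [Vh h01 _].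
  apply: (le_poslin latV linL) => //; first exact: latt_cst.
  by move=> x; case/andP: (h01 x).
apply: le_inner_vol; split; first exact: latt_cst.
  by move=> x; rewrite ler01 lexx.
by move=> x /(_ I).
Qed.

Lemma inner_vol0 : inner_vol set0 = 0.
Proof.
apply/eqP; rewrite eq_le inner_vol_ge0 andbT; apply: inner_vol_le => h [_ _ h0].
have -> : h = fun=> 0 by apply/funext => x; exact: h0.
by rewrite (poslin_cst latV linL) mul0r.
Qed.

(** Lowering by [e] turns a function that is at most [e] off [U] into one that vanishes there;
    [le_trunc] bounds the loss by [e * L (fun=> 1)]. *)
Lemma below_trunc U h e : V h -> (forall x, 0 <= h x <= 1) -> 0 <= e ->
  (forall x, e < h x -> U x) -> below U (fun x => Num.max (h x - e) 0).
Proof.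
move=> Vh h01 e0 hU; split.
- apply: (latt_max latV) (latt_cst latV 0); apply: lattB => //.
  exact: latt_cst.
- move=> x; rewrite le_max lexx orbT ge_max ler01 andbT.
  by have /andP[_ h1] := h01 x; lra.
- move=> x nUx; apply/max_idPr; rewrite subr_le0 leNgt.
  by apply/negP => /hU.
Qed.

Lemma le_trunc h e : V h ->
  L h <= L (fun x => Num.max (h x - e) 0) + e * L (fun=> 1).
Proof.
move=> Vh; have Ve : V (fun=> e) by exact: latt_cst.
rewrite -(poslin_cst latV linL) -(poslinD linL)//.
  apply: (le_poslin latV linL) => //.
    by apply/(lattD latV)/Ve/(latt_max latV)/(latt_cst latV) => //; exact: lattB.
  by move=> x; rewrite -lerBlDr le_max lexx.
by apply/(latt_max latV)/(latt_cst latV) => //; exact: lattB.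
Qed.

Lemma inner_vol_trunc U h e : V h -> (forall x, 0 <= h x <= 1) -> 0 <= e ->
  (forall x, e < h x -> U x) -> L h <= inner_vol U + e * L (fun=> 1).
Proof.
move=> Vh h01 e0 hU; apply: le_trans (le_trunc e Vh) _.
by rewrite lerD2r; apply: le_inner_vol; exact: below_trunc.
Qed.

(** A function [g] below the union splits as [u + (g - u)], with [u] the minimum of [g] and a
    Urysohn function [h] that vanishes off [U] and is [1] on the part of [e <= g] outside [W]. Then
    [u] lies below [U], and [g - u] is at most [e] off [W]. *)
Lemma inner_volU U W : open U -> open W ->
  inner_vol (U `|` W) <= inner_vol U + inner_vol W.
Proof.
move=> oU oW; apply: inner_vol_le => g [Vg g01 g0].
apply: (ler_addeps poslin1_ge0) => e e0.
have [h Vh [h01 h1 h0]] : exists2 h, V h &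
    [/\ (forall x, 0 <= h x <= 1),
        (forall x, ([set x | e <= g x] `\` W) x -> h x = 1) &
        (forall x, (~` U) x -> h x = 0)].
  apply: (lattice_separate latV ctsV sepV cT).
  - by apply: closedI; [exact/closed_ler_fun/ctsV|exact: open_closedC].
  - exact: open_closedC.
  - rewrite -subset0 => x [[/= egx nWx] nUx].
    by move: egx; rewrite g0 ?leNgt ?e0// => -[].
pose u x := Num.min (g x) (h x).
have Vu : V u by exact: latt_min.
have uU : below U u.
  split=> // x; first by rewrite le_min ge_min; case/andP: (g01 x) => -> ->;
    case/andP: (h01 x) => ->.
  by move=> nUx; rewrite /u h0//; apply/min_idPr; case/andP: (g01 x).
have Vgu : V (fun x => g x - u x) by exact: lattB.
have wW : below W (fun x => Num.max (g x - u x - e) 0).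
  apply: below_trunc => //; last 1 first.
  - move=> x egu; apply: contrapT => nWx.
    have [egx|gxe] := leP e (g x).
      move: egu; rewrite /u h1// min_l ?subrr ?ltNge ?(ltW e0)//.
      by case/andP: (g01 x).
    have : 0 <= u x by case: uU => _ /(_ x)/andP[].
    by move: egu gxe; lra.
  - move=> x; have := g01 x; have : 0 <= u x by case: uU => _ /(_ x)/andP[].
    have : u x <= g x by rewrite ge_min lexx.
    lra.
  - exact: ltW.
have -> : L g = L u + L (fun x => g x - u x).
  by rewrite -(poslinD linL)//; congr L; apply/funext => x; lra.
have := le_trunc e Vgu.
have := le_inner_vol uU; have := le_inner_vol wW; lra.
Qed.

Lemma inner_vol_bigcup_lt (U : (set T)^nat) n : (forall i, open (U i)) ->
  inner_vol (\bigcup_(i < n) U i) <= \sum_(i < n) inner_vol (U i).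
Proof.
move=> oU; elim: n => [|n IH].
  by rewrite bigcup_mkord !big_ord0 inner_vol0.
rewrite big_ord_recr bigcup_mkord big_ord_recr /= -bigcup_mkord.
apply: le_trans (inner_volU _ _) _ => //; first exact: bigcup_open.
by rewrite lerD2r.
Qed.

(** By compactness, finitely many of the [U i] already cover the set where [h] exceeds [e];
    truncating [h] at [e] does the rest. *)
Lemma below_bigcup (U : (set T)^nat) h e : (forall i, open (U i)) ->
  below (\bigcup_i U i) h -> 0 < e ->
  exists n, L h <= \sum_(i < n) inner_vol (U i) + e * L (fun=> 1).
Proof.
move=> oU [Vh h01 h0] e0.
have [n hn] : exists n, forall x, setT x -> e < h x -> (\bigcup_(i < n) U i) x.
  apply: (compact_ind (P := fun A => exists n, forall x, A x -> e < h x ->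
    (\bigcup_(i < n) U i) x) cT).
  - by exists 0%N.
  - by move=> A B AB [n nB]; exists n => x /AB; exact: nB.
  - move=> A B [n nA] [m mB]; exists (maxn n m) => x [Ax|Bx] ehx.
      by have [i /= ni Ui] := nA _ Ax ehx; exists i => //=; rewrite leq_max ni.
    by have [i /= mi Ui] := mB _ Bx ehx; exists i => //=; rewrite leq_max mi orbT.
  - move=> x _; have [ehx|hxe] := leP e (h x).
      have [i _ Uix] : (\bigcup_i U i) x.
        by apply: contrapT => /h0 hx0; move: ehx; rewrite hx0 leNgt e0.
      exists (U i); first exact: open_nbhs_nbhs.
      by exists i.+1 => y Uy _; exists i => /=.
    exists [set y | h y < e].
      by apply: open_nbhs_nbhs; split => //; exact/open_ltr_fun/ctsV.
    by exists 0%N => y /= /ltW; rewrite leNgt => /negP.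
exists n; apply: le_trans (inner_vol_trunc Vh h01 (ltW e0) _) _.
  by move=> x; exact: (hn x).
by rewrite lerD2r; exact: inner_vol_bigcup_lt.
Qed.

Lemma has_lbound_outer A :
  has_lbound [set inner_vol U | U in [set U | open U /\ A `<=` U]].
Proof. by exists 0 => _ [U _ <-]; exact: inner_vol_ge0. Qed.

Lemma outer_vol_le A U : open U -> A `<=` U -> outer_vol A <= inner_vol U.
Proof. by move=> oU AU; apply: ge_inf; [exact: has_lbound_outer|exists U]. Qed.

Lemma outer_vol_ge A c :
  (forall U, open U -> A `<=` U -> c <= inner_vol U) -> c <= outer_vol A.
Proof.
move=> Ac; apply: lb_le_inf.
  by exists (inner_vol setT), setT => //; split => //; exact: openT.
by move=> _ [U [oU AU] <-]; exact: Ac.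
Qed.

Lemma outer_vol_adherent A e : 0 < e ->
  exists2 U, open U /\ A `<=` U & inner_vol U < outer_vol A + e.
Proof.
move=> e0; have [|_ [U UA <-] Ue] := @inf_adherent _
  [set inner_vol U | U in [set U | open U /\ A `<=` U]] _ e0.
  split; last exact: has_lbound_outer.
  by exists (inner_vol setT), setT => //; split => //; exact: openT.
by exists U.
Qed.

Lemma outer_vol_open U : open U -> outer_vol U = inner_vol U.
Proof.
move=> oU; apply/eqP; rewrite eq_le outer_vol_le//=.
by apply: outer_vol_ge => W _; exact: inner_vol_mono.
Qed.

Lemma outer_vol_ge0 A : 0 <= outer_vol A.
Proof. by apply: outer_vol_ge => U _ _; exact: inner_vol_ge0. Qed.

Lemma outer_vol_mono A B : A `<=` B -> outer_vol A <= outer_vol B.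
Proof.
move=> AB; apply: outer_vol_ge => U oU BU; apply: outer_vol_le => //.
exact: subset_trans BU.
Qed.

Lemma outer_vol0 : outer_vol set0 = 0.
Proof. by rewrite outer_vol_open ?inner_vol0//; exact: open0. Qed.

Lemma outer_vol_sigma_subadditive :
  sigma_subadditive (fun A => (outer_vol A)%:E).
Proof.
move=> F; apply/lee_addgt0Pr => e e0.
apply: le_trans (epsilon_trick _ _ (ltW e0)); last first.
  by move=> n; rewrite lee_fin outer_vol_ge0.
have pos2 n : 0 < e / (2 ^ n.+1)%:R by rewrite divr_gt0// ltr0n expn_gt0.
have {pos2}/choice[U UP] n : exists U, [/\ open U, F n `<=` U &
    inner_vol U < outer_vol (F n) + e / (2 ^ n.+1)%:R].
  by have [U [oU FU] ltU] := outer_vol_adherent (F n) (pos2 n); exists U.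
have oU i : open (U i) by case: (UP i).
apply: (@le_trans _ _ (inner_vol (\bigcup_i U i))%:E).
  rewrite lee_fin; apply: outer_vol_le; first exact: bigcup_open.
  by move=> x [i _ Fx]; exists i => //; case: (UP i) => _ + _; exact.
apply/lee_addgt0Pr => e' e'0.
have [h hU hUe] : exists2 h, below (\bigcup_i U i) h &
    inner_vol (\bigcup_i U i) < L h + e' / 2.
  have [|_ [h hU <-] hUe] := @sup_adherent _
    (L @` below (\bigcup_i U i)) _ (divr_gt0 e'0 (@ltr0n R 2)).
  - split; last exact: has_ubound_below.
    by exists (L (fun=> 0)), (fun=> 0) => //; exact: below0.
  - by exists h => //; rewrite -ltrBlDr.
(* [L (fun=> 1)] may be zero, so the error is divided by [L (fun=> 1) + 1]. *)
have c1 : 0 < L (fun=> 1) + 1 by rewrite ltr_wpDl// poslin1_ge0.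
have [n hn] := below_bigcup oU hU (divr_gt0 (divr_gt0 e'0 (@ltr0n R 2)) c1).
apply: (@le_trans _ _ ((\sum_(i < n) inner_vol (U i)) + e')%:E).
  rewrite lee_fin; apply/ltW/(lt_le_trans hUe); rewrite -lerBrDr.
  apply: (le_trans hn); rewrite -addrA lerD2l.
  rewrite lerBrDr [leRHS]splitr lerD2r -(mulrA (e' / 2)) ler_piMr ?divr_ge0 ?(ltW e'0)//.
  by rewrite mulrC ler_pdivrMr// mul1r lerDl.
rewrite EFinD leeD2r// -sumEFin.
apply: (@le_trans _ _
    (\sum_(i < n) ((outer_vol (F i))%:E + (e / (2 ^ i.+1)%:R)%:E))%E).
  by apply: lee_sum => i _; rewrite -EFinD lee_fin ltW//; case: (UP i).
rewrite -(big_mkord xpredT (fun i => (outer_vol (F i))%:E +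
  (e / (2 ^ i.+1)%:R)%:E)%E).
apply: nneseries_lim_ge => k _ _.
by rewrite -EFinD lee_fin addr_ge0 ?outer_vol_ge0// divr_ge0// ltW.
Qed.

(** For open [W] containing [X], take [h] below [W] intersected with [U], and [g] below the part of
    [W] where [h < e]. Since [g] vanishes where [e <= h], the sum of [g] and the truncation of [h]
    is still at most [1], hence lies below [W]. *)
Lemma outer_vol_caratheodory U X : open U ->
  outer_vol (X `&` U) + outer_vol (X `&` ~` U) <= outer_vol X.
Proof.
move=> oU; apply: outer_vol_ge => W oW XW.
apply: (@le_trans _ _ (inner_vol (W `&` U) + outer_vol (W `&` ~` U))).
  apply: lerD; last by apply: outer_vol_mono; exact: setSI.
  by apply: outer_vol_le; [exact: openI|exact: setSI].
rewrite -lerBrDr; apply: inner_vol_le => h [Vh h01 h0]; rewrite lerBrDr.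
apply: (ler_addeps poslin1_ge0) => e e0.
have cC : closed [set x | e <= h x] by exact/closed_ler_fun/ctsV.
have oWC : open (W `&` ~` [set x | e <= h x]).
  by apply: openI => //; exact: closed_openC.
apply: (@le_trans _ _ (L h + inner_vol (W `&` ~` [set x | e <= h x]))).
  rewrite lerD2l; apply: outer_vol_le => // x [Wx nUx]; split=> //= ehx.
  by move: ehx; rewrite h0 ?leNgt ?e0// => -[].
rewrite -lerBrDl; apply: inner_vol_le => g [Vg g01 g0]; rewrite lerBrDl.
apply: le_trans (lerD (le_trunc e Vh) (lexx (L g))) _.
have [Vt t01 t0] : below (W `&` U) (fun x => Num.max (h x - e) 0).
  apply: below_trunc => //; first exact: ltW.
  move=> x ehx; apply: contrapT => /h0 hx0.
  by move: ehx; rewrite hx0 ltNge (ltW e0).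
rewrite addrAC lerD2r -(poslinD linL)//; apply: le_inner_vol; split.
- exact: lattD.
- move=> x; have [ehx|hxe] := leP e (h x).
    by rewrite (g0 x) ?addr0// => -[_]; apply.
  by rewrite [Num.max _ _]max_r ?add0r ?subr_le0// ltW.
- move=> x nWx; rewrite t0 ?g0 ?addr0//; first by case.
  by case.
Qed.

End InnerVolume.

(** * Regular Borel measures on a compact space *)

Section BorelMeasure.
Variables (R : realType) (T : ptopologicalType).
Hypothesis cT : compact [set: T].
Local Notation BT := (g_sigma_algebraType (@open T)).
Implicit Types (mu nu : {measure set BT -> \bar R}) (f g : T -> R).

Lemma borel_open (U : set T) : open U -> measurable (U : set BT).
Proof. exact: sub_sigma_algebra. Qed.

Lemma borel_closed (C : set T) : closed C -> measurable (C : set BT).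
Proof.
move=> clC; rewrite -(setCK C); apply: measurableC; apply: borel_open.
exact: closed_openC.
Qed.

Lemma continuous_borel f : continuous f -> measurable_fun [set: BT] (f : BT -> R).
Proof.
move=> cf; apply: (measurability (@RGenOInfty.G R)).
  exact: RGenOInfty.measurableE.
move=> _ [_ [c ->] <-]; rewrite setTI; apply: borel_open.
rewrite (_ : _ @^-1` _ = [set x | c < f x]); first exact: open_gtr_fun.
by apply/seteqP; split => x /=; rewrite in_itv/= andbT.
Qed.

Lemma continuous_bounded f : continuous f ->
  exists2 M, 0 < M & forall x, `|f x| <= M.
Proof.
move=> cf; have [M [_ Mf]] : bounded_set (f @` [set: T]).
  apply: (@compact_bounded R R^o); apply: continuous_compact => //.
  exact: continuous_subspaceT.
exists (`|M| + 1); first by rewrite ltr_wpDl.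
by move=> x; apply: Mf; [rewrite ltr_pwDr// ler_norm|exists x].
Qed.

Lemma continuous_integrable mu f (D : set BT) : (mu setT < +oo)%E ->
  measurable D -> continuous f -> mu.-integrable D (EFin \o f).
Proof.
move=> mufin mD cf; apply: measurable_bounded_integrable => //.
- by apply: le_lt_trans mufin; apply: le_measure; rewrite ?inE.
- by apply: measurable_funTS; exact: continuous_borel.
- have [M M0 fM] := continuous_bounded cf.
  by exists M; split=> [|N MN x _]; [rewrite num_real|apply: le_trans (ltW MN)].
Qed.

Lemma EFin_Rintegral mu f (D : set BT) : (mu setT < +oo)%E ->
  measurable D -> continuous f ->
  (\int[mu]_(x in D) (f x)%:E)%E = (\int[mu]_(x in D) f x)%:E.
Proof.
move=> mufin mD cf; rewrite /Rintegral fineK//.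
by apply: integrable_fin_num => //; exact: continuous_integrable.
Qed.

Lemma Rintegral_indicZ mu (A : set BT) c : (mu setT < +oo)%E -> measurable A ->
  mu.-integrable setT (EFin \o (fun x => c * \1_A x)) /\
  \int[mu]_x (c * \1_A x) = c * fine (mu A).
Proof.
move=> mufin mA.
have iA : mu.-integrable setT (EFin \o (\1_A : BT -> R)).
  apply: measurable_bounded_integrable => //; exists 1; split=> // M M1 x _ /=.
  by rewrite (le_trans _ (ltW M1))// indicE ger0_norm// lern1; case: (_ \in _).
split; last by rewrite RintegralZl// /Rintegral integral_indic// setIT.
rewrite (_ : _ \o _ = (fun x => c%:E * (\1_A x)%:E)%E) //.
exact: integrableZl.
Qed.

Lemma measure_le_Rintegral mu (A : set BT) f c : (mu setT < +oo)%E ->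
  measurable A -> continuous f -> (forall x, 0 <= f x) ->
  (forall x, A x -> c <= f x) -> c * fine (mu A) <= \int[mu]_x f x.
Proof.
move=> mufin mA cf f0 Af.
have [iA <-] := Rintegral_indicZ c mufin mA.
apply: le_Rintegral => //; first exact: continuous_integrable.
move=> x _; rewrite indicE; case: (boolP (x \in A)) => [|_].
  by rewrite inE mulr1 => /Af.
by rewrite mulr0.
Qed.

Lemma Rintegral_le_measure mu (A : set BT) f : (mu setT < +oo)%E ->
  measurable A -> continuous f -> (forall x, f x <= 1) ->
  (forall x, ~ A x -> f x = 0) -> \int[mu]_x f x <= fine (mu A).
Proof.
move=> mufin mA cf f1 Af.
have [iA] := Rintegral_indicZ 1 mufin mA; rewrite mul1r => <-.
apply: le_Rintegral => //; first exact: continuous_integrable.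
move=> x _; rewrite indicE mul1r; case: (boolP (x \in A)) => [//|].
by rewrite notin_setE => /Af ->.
Qed.

(** The condition of [regular_measure], stated over an arbitrary pointed space. *)
Definition regular_borel mu := (mu setT < +oo)%E /\
  forall A : set BT, measurable A ->
    mu A = ereal_sup [set mu C | C in [set C : set T | compact C /\ C `<=` A]] /\
    mu A = ereal_inf [set mu U | U in [set U : set T | open U /\ A `<=` U]].

Section lattice.
Variable V : set (T -> R).
Hypotheses (latV : vector_lattice V) (ctsV : forall f, V f -> continuous f)
  (sepV : forall x y, x <> y -> exists2 f, V f & f x <> f y).

(** For each open [U] containing [C], some [h] in [V] lies between the indicators of [C] and [U], so
    [mu C] is at most the common integral of [h], which is at most [nu U]; outer regularity of [nu]
    concludes. *)
Lemma regular_compact_le mu nu (C : set T) : regular_borel mu -> regular_borel nu ->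
  (forall f, V f -> \int[mu]_x f x = \int[nu]_x f x) ->
  compact C -> (mu C <= nu C)%E.
Proof.
move=> [mufin _] [nufin nuR] munu cC.
have clC : closed C.
  exact: compact_closed (separating_hausdorff ctsV sepV) cC.
have [_ ->] := nuR _ (borel_closed clC).
apply: le_ereal_inf_tmp => _ [U [oU CU] <-].
have [|h Vh [h01 hC hU]] :=
  lattice_separate latV ctsV sepV cT clC (open_closedC oU).
  by apply/disjoints_subset; rewrite setCK.
have mC := borel_closed clC; have mU := borel_open oU.
have ch := ctsV Vh.
have finm (m : {measure set BT -> \bar R}) (A : set BT) :
    (m setT < +oo)%E -> measurable A -> m A \is a fin_num.
  move=> mfin mA; rewrite ge0_fin_numE//; apply: le_lt_trans mfin.
  by apply: le_measure; rewrite ?inE.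
rewrite -(fineK (finm mu _ mufin mC)) -(fineK (finm nu _ nufin mU)) lee_fin.
apply: (@le_trans _ _ (\int[mu]_x h x)).
  rewrite -[leLHS]mul1r; apply: measure_le_Rintegral => // x.
    by case/andP: (h01 x).
  by move=> /hC ->.
rewrite munu//; apply: Rintegral_le_measure => // x.
by case/andP: (h01 x).
Qed.

Lemma regular_unique mu nu : regular_borel mu -> regular_borel nu ->
  (forall f, V f -> \int[mu]_x f x = \int[nu]_x f x) ->
  forall A : set BT, measurable A -> mu A = nu A.
Proof.
move=> rmu rnu munu A mA.
have [-> _] := rmu.2 _ mA; have [-> _] := rnu.2 _ mA; congr ereal_sup.
apply: eq_imagel => C [cC _]; apply/eqP; rewrite eq_le.
by apply/andP; split; apply: regular_compact_le => // f Vf; rewrite munu.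
Qed.

Section Representation.
Variable L : (T -> R) -> R.
Hypothesis linL : positive_linear V L.

(** Open sets satisfy the Caratheodory criterion for [outer_vol], hence so do all Borel sets, and
    [outer_vol] restricts to a measure. Outer regularity is built into its definition. *)
Lemma riesz_measure : exists2 mu : {measure set BT -> \bar R},
  regular_borel mu &
  mu setT = (L (fun=> 1))%:E /\ forall U : set T, open U -> mu U = (inner_vol V L U)%:E.
Proof.
pose m (A : set T) := (outer_vol V L A)%:E.
have m0 : m set0 = 0%E by rewrite /m (outer_vol0 latV linL).
have mge0 A : (0 <= m A)%E by rewrite lee_fin (outer_vol_ge0 latV linL).
have mle : {homo m : A B / A `<=` B >-> (A <= B)%E}.
  by move=> A B AB; rewrite lee_fin (outer_vol_mono latV linL).
pose om : {outer_measure set T -> \bar R} := HB.pack_for (outer_measure R T) m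
  (isOuterMeasure.Build R T m m0 mge0 mle
    (outer_vol_sigma_subadditive latV ctsV sepV cT linL)).
have mcara (A : set BT) : measurable A -> caratheodory_measurable om A.
  apply: (smallest_sub (X := [set A | caratheodory_measurable om A])).
    exact: (sigma_algebra_measurable (caratheodory_type om)).
  move=> U oU; apply: le_caratheodory_measurable => X.
  have := outer_vol_caratheodory latV ctsV linL X oU.
  by rewrite -lee_fin EFinD.
have madd : semi_sigma_additive (m : set BT -> \bar R).
  move=> F mF tF mUF.
  apply: (caratheodory_measure_sigma_additive (mu := om)) => //.
    by move=> i; exact: mcara.
  exact: mcara.
pose mu : {measure set BT -> \bar R} := HB.pack_for {measure set BT -> \bar R}
  (m : set BT -> \bar R) (isMeasure.Build _ BT R m m0 mge0 madd).
have muU (U : set T) : open U -> mu U = (inner_vol V L U)%:E.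
  by move=> oU; rewrite /mu/= /m (outer_vol_open latV linL).
have muT : mu setT = (L (fun=> 1))%:E.
  by rewrite muU ?(inner_volT latV linL)//; exact: openT.
have mufin (A : set BT) : mu A \is a fin_num by [].
have outerR (A : set BT) : mu A =
    ereal_inf [set mu U | U in [set U : set T | open U /\ A `<=` U]].
  apply/eqP; rewrite eq_le; apply/andP; split.
    by apply: le_ereal_inf_tmp => _ [U [_ AU] <-]; exact: (mle _ _ AU).
  apply/lee_addgt0Pr => e e0.
  have [U [oU AU] ltU] := outer_vol_adherent latV linL A e0.
  apply: (@le_trans _ _ (mu U)); first by apply: ereal_inf_lbound; exists U.
  by rewrite muU// -EFinD lee_fin ltW.
exists mu => //; split; first by rewrite muT ltry.
move=> A mA; split=> //.
apply/eqP; rewrite eq_le; apply/andP; split; last first.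
  by apply: ge_ereal_sup => _ [C [_ CA] <-]; exact: (mle _ _ CA).
apply/lee_addgt0Pr => e e0.
(* Inner regularity by complements: if an open [U] contains the complement of [A] with excess below
   [e], the complement of [U] is a compact subset of [A] missing measure at most [e]. *)
have [U [oU AU] ltU] := outer_vol_adherent latV linL (~` A) e0.
have clC : closed (~` U) by exact: open_closedC.
rewrite -leeBlDr//; apply: (@le_trans _ _ (mu (~` U))); last first.
  apply: ereal_sup_ubound; exists (~` U) => //; split; last exact: subsetCl.
  by apply: (subclosed_compact clC cT).
have EA : mu setT = (mu A + mu (~` A))%E.
  by rewrite -measureU ?setUCr ?setICr//; exact: measurableC.
have EU : mu setT = (mu U + mu (~` U))%E.
  rewrite -measureU ?setUCr ?setICr//; first exact: borel_open.
  exact: borel_closed.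
move: EA; rewrite EU => EA.
rewrite leeBlDr// -(leeD2rE _ _ (mufin (~` A))) -EA addeC -addeA leeD2lE//.
by rewrite addeC muU// -EFinD lee_fin ltW.
Qed.

(** A layer decomposition gives [L f <= I f] for [f] with values in the unit interval; the same
    inequality for [1 - f] gives equality, and rescaling reaches all of [V]. *)
Lemma riesz_representation : exists2 mu : {measure set BT -> \bar R},
  regular_borel mu & forall f, V f -> (\int[mu]_x (f x)%:E)%E = (L f)%:E.
Proof.
have [mu rmu [muT muU]] := riesz_measure; exists mu => //.
have mufin := rmu.1.
have V1 c : V (fun=> c) by exact: latt_cst.
pose I f := \int[mu]_x f x.
have linI : positive_linear V I.
  split=> [f g Vf Vg|c f Vf|f Vf f0].
  - by rewrite /I RintegralD//; apply: continuous_integrable => //; exact: ctsV.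
  - by rewrite /I RintegralZl//; apply: continuous_integrable => //; exact: ctsV.
  - exact: Rintegral_ge0.
have I1 : I (fun=> 1) = L (fun=> 1).
  by rewrite /I Rintegral_cst// mul1r muT.
pose vol := inner_vol V L.
have Imin f e : V f -> 0 < e -> (forall x, 0 <= f x) ->
    e * vol [set x | e < f x] <= I (fun x => Num.min (f x) e).
  move=> Vf e0 f0.
  have oU : open [set x | e < f x] by exact/open_gtr_fun/ctsV.
  have -> : vol [set x | e < f x] = fine (mu [set x | e < f x]) by rewrite muU.
  apply: measure_le_Rintegral => //.
  - exact: borel_open.
  - by apply/ctsV/(latt_min latV).
  - by move=> x; rewrite le_min f0 ltW.
  - by move=> x /= exf; rewrite le_min lexx ltW.
have Lmin f e : V f -> 0 < e -> (forall x, 0 <= f x) ->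
    L (fun x => Num.min (f x) e) <= e * vol [set x | 0 < f x].
  move=> Vf e0 f0; rewrite -ler_pdivrMl// -(poslinZ linL); last exact: latt_min.
  apply: (le_inner_vol latV linL); split.
  - by apply/(lattZ latV)/(latt_min latV).
  - move=> x; rewrite mulr_ge0 ?invr_ge0 ?(ltW e0)//=; last first.
      by rewrite le_min f0 ltW.
    by rewrite ler_pdivrMl// mulr1 ge_min lexx orbT.
  - move=> x /= /negP; rewrite -leNgt => fx0.
    have -> : f x = 0 by apply/eqP; rewrite eq_le fx0 f0.
    by rewrite min_l ?mulr0// ltW.
(* Induction on [n], cutting [f] at height [e] into [(f - e)^+] and
   [min f e]. *)
have key n f e : V f -> 0 < e -> (forall x, 0 <= f x <= n%:R * e) ->
    L f <= I f + e * vol [set x | 0 < f x].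
  elim: n f => [|n IH] f Vf e0 f0n.
    rewrite (_ : f = fun=> 0).
      rewrite (poslin_cst latV linL) (poslin_cst latV linI) !mul0r add0r.
      by rewrite mulr_ge0 ?(ltW e0)//; exact: inner_vol_ge0.
    by apply/funext => x; apply/eqP; rewrite eq_le -{1}(mul0r e) andbC; exact: f0n.
  have f0 x : 0 <= f x by case/andP: (f0n x).
  pose g x := Num.max (f x - e) 0.
  have Vfm : V (fun x => Num.min (f x) e) by exact: latt_min.
  have Vg : V g by apply: latt_max => //; exact: lattB.
  have fE : f = fun x => g x + Num.min (f x) e.
    apply/funext => x; rewrite /g.
    by have [|] := leP (f x) e => fe; [rewrite max_r|rewrite max_l]; lra.
  have Lg : L g <= I g + e * vol [set x | e < f x].
    rewrite (_ : [set x | e < f x] = [set x | 0 < g x]).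
      apply: IH => // x; rewrite le_max lexx orbT ge_max.
      rewrite mulr_ge0 ?(ltW e0)// andbT.
      by have /andP[_] := f0n x; rewrite -natr1 mulrDl mul1r; lra.
    by apply/seteqP; split=> x /=; rewrite lt_max ltxx orbF subr_gt0.
  (* The error [e * vol [set x | e < f x]] left by [g] is absorbed by the integral of the lower
     layer, through [Imin]; [Lmin] contributes the new error. The errors thus telescope instead of
     adding up over the layers. *)
  have := Imin f e Vf e0 f0; have := Lmin f e Vf e0 f0.
  have -> : L f = L g + L (fun x => Num.min (f x) e).
    by rewrite [in LHS]fE (poslinD linL).
  have -> : I f = I g + I (fun x => Num.min (f x) e).
    by rewrite [in LHS]fE (poslinD linI).
  move: Lg; lra.
have L01 f : V f -> (forall x, 0 <= f x <= 1) -> L f <= I f.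
  move=> Vf f01; apply: (ler_addeps (inner_vol_ge0 latV linL setT)) => e e0.
  have [n en] : exists n, 1 <= n%:R * e.
    exists (Num.bound e^-1); rewrite -ler_pdivrMr// div1r ltW//.
    by apply: archi_boundP; rewrite invr_ge0 ltW.
  apply: le_trans (key n f e Vf e0 _) _.
    by move=> x; have /andP[-> /le_trans/(_ en)] := f01 x.
  by rewrite lerD2l ler_pM2l//; apply: inner_vol_mono.
have LI01 f : V f -> (forall x, 0 <= f x <= 1) -> L f = I f.
  move=> Vf f01; apply/eqP; rewrite eq_le L01//=.
  have : L (fun x => 1 - f x) <= I (fun x => 1 - f x).
    apply: L01 => [|x]; first exact: lattB.
    by have := f01 x; rewrite subr_ge0 gerBl andbC.
  by rewrite (poslinB latV linL)// (poslinB latV linI)// I1 lerD2l lerN2.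
move=> f Vf; rewrite EFin_Rintegral//; last exact: ctsV.
have [M M0 fM] := continuous_bounded (ctsV Vf).
have M20 : M + M != 0 by rewrite gt_eqF// addr_gt0.
(* As [f] takes values between [-M] and [M], [g] takes values in the unit interval. *)
pose g x := (M + M)^-1 * (f x + M).
have VfM : V (fun x => f x + M) by exact: lattD.
have Vg : V g by exact: lattZ.
have fE : f = fun x => (M + M) * g x - M.
  by apply/funext => x; rewrite /g mulVKf// addrK.
have VMg : V (fun x => (M + M) * g x) by exact: lattZ.
rewrite -/(I f) fE (poslinB latV linL)// (poslinB latV linI)//.
rewrite (poslinZ linL)// (poslinZ linI)// LI01//.
  by rewrite (poslin_cst latV linL) (poslin_cst latV linI) I1.
move=> x; have := fM x; rewrite ler_norml /g => /andP[fM1 fM2].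
rewrite mulr_ge0 ?invr_ge0//; [|lra|lra].
by rewrite ler_pdivrMl ?addr_gt0// mulr1 lerD2r.
Qed.

End Representation.
End lattice.
End BorelMeasure.

(** * Additive maps on a pseudo effect algebra *)

Section AdditiveMaps.
Variables (R : realType) (E : Type) (plus : E -> E -> option E) (zero one : E).
Hypotheses (HE : pseudo_effect_algebra plus zero one) (HRDP : RDP plus).
Implicit Types u v w m : E -> R.

(** States without the normalization at [one]: the cone over the state space, together with its apex
    [0]. *)
Definition additive_map m := (forall a, 0 <= m a) /\
  (forall a b c, plus a b = Some c -> m c = m a + m b).

Lemma additive_map0 : additive_map (fun=> 0).
Proof. by split=> // *; rewrite addr0. Qed.

Lemma additive_mapD u v : additive_map u -> additive_map v ->
  additive_map (fun a => u a + v a).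
Proof.
move=> [u0 uD] [v0 vD]; split=> [a|a b c abc]; first exact: addr_ge0.
by rewrite (uD _ _ _ abc) (vD _ _ _ abc) addrACA.
Qed.

Lemma additive_mapB u v : additive_map u -> additive_map v ->
  (forall a, v a <= u a) -> additive_map (fun a => u a - v a).
Proof.
move=> [u0 uD] [v0 vD] vu; split=> [a|a b c abc]; first by rewrite subr_ge0.
by rewrite (uD _ _ _ abc) (vD _ _ _ abc) opprD addrACA.
Qed.

(** * Meets and the refinement property of additive maps *)

Lemma plus_zero a : plus a zero = Some a.
Proof.
have [assoc compl _ top] := HE.
(* The complement of [one] is [zero]. If [e + a = 1], then [e + (a + 0) = 1 + 0 = 1], and uniqueness
   of the complement of [e] gives [a + 0 = a]. *)
have [[z [onez _]] _] := compl one.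
have z0 : z = zero by apply: top; left; rewrite onez.
have [_ [e [ea _]]] := compl a.
have [[d [_ ed]] _] := compl e.
have := assoc e a zero; rewrite ea /= -[X in plus one X]z0 onez.
case: (plus a zero) => // x /esym ex.
by rewrite -(ed _ ex) (ed _ ea).
Qed.

Lemma additive_map_one u : additive_map u -> u one = 0 -> forall a, u a = 0.
Proof.
move=> [u0 uD] u1 a; have [_ compl _ _] := HE.
have [[d [ad _]] _] := compl a.
apply/eqP; rewrite eq_le u0 andbT -u1 (uD _ _ _ ad) lerDl.
exact: u0.
Qed.

(** The Riesz-Kantorovich formula for the greatest lower bound of two additive maps. *)
Definition meet m1 m2 a : R :=
  inf [set m1 bc.1 + m2 bc.2 | bc in [set bc | plus bc.1 bc.2 = Some a]].

Lemma meet_le m1 m2 a b c : additive_map m1 -> additive_map m2 ->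
  plus b c = Some a -> meet m1 m2 a <= m1 b + m2 c.
Proof.
move=> [m1ge0 _] [m2ge0 _] bca; apply: ge_inf; last by exists (b, c).
by exists 0 => _ [bc _ <-]; exact: addr_ge0.
Qed.

Lemma meet_ge m1 m2 a x :
  (forall b c, plus b c = Some a -> x <= m1 b + m2 c) -> x <= meet m1 m2 a.
Proof.
move=> xle; apply: lb_le_inf; last by move=> _ [[b c] bca <-]; exact: xle.
by exists (m1 a + m2 zero), (a, zero) => //=; exact: plus_zero.
Qed.

(* [c1 + b2 = d + c1] for some [d], and [d] and [b2] have the same value under
   every additive map: this replaces commutativity in the regrouping. *)
Lemma additive_meet m1 m2 : additive_map m1 -> additive_map m2 ->
  additive_map (meet m1 m2).
Proof.
move=> Am1 Am2; have [m1ge0 m1D] := Am1; have [m2ge0 m2D] := Am2.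
have [assoc _ swap _] := HE.
split=> [a|a1 a2 a a12]; first by apply: meet_ge => b c _; exact: addr_ge0.
apply/eqP; rewrite eq_le; apply/andP; split; last first.
  apply: meet_ge => b c bca.
  (* Superadditivity is where (RDP) enters: it cuts [b] and [c] along [a1] and [a2]. *)
  have [d1 [d2 [d3 [d4 [d12 d34 d13 d24]]]]] := HRDP a12 bca.
  rewrite (m1D _ _ _ d13) (m2D _ _ _ d24) addrACA.
  by apply: lerD; exact: meet_le.
rewrite -lerBlDr; apply: meet_ge => b1 c1 bc1.
rewrite lerBlDr -lerBlDl; apply: meet_ge => b2 c2 bc2; rewrite lerBlDl.
have := assoc b1 c1 a2; rewrite bc1 /= a12.
case c1a2 : (plus c1 a2) => [x|//] /esym b1x.
have := assoc c1 b2 c2; rewrite bc2 /= c1a2.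
case c1b2 : (plus c1 b2) => [y|//] /= yc2.
have [d [_ [dc1 _]]] := swap _ _ _ c1b2.
have := assoc d c1 c2; rewrite dc1 /= yc2.
case c1c2 : (plus c1 c2) => [z|//] /esym /= dz.
have := assoc b1 d z; rewrite dz /= b1x.
case b1d : (plus b1 d) => [w|//] /= wz.
have m1d : m1 d = m1 b2.
  by apply: (addIr (m1 c1)); rewrite -(m1D _ _ _ dc1) addrC -(m1D _ _ _ c1b2).
apply: le_trans (meet_le Am1 Am2 wz) _.
by rewrite (m1D _ _ _ b1d) (m2D _ _ _ c1c2) m1d addrACA.
Qed.

(** The corner [w11] is the meet of [u1] and [v1], and the other entries are forced as differences.
    The point to check is [w22 >= 0]: for [b + c = a], [v1 b <= u1 b + u2 b] yields
    [v1 a - u2 a <= u1 b + v1 c], and the infimum over [b] and [c] is the meet. *)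
Lemma additive_refine u1 u2 v1 v2 :
  additive_map u1 -> additive_map u2 -> additive_map v1 -> additive_map v2 ->
  (forall a, u1 a + u2 a = v1 a + v2 a) ->
  exists w11 w12 w21 w22,
    [/\ additive_map w11, additive_map w12, additive_map w21 & additive_map w22] /\
    [/\ (forall a, u1 a = w11 a + w12 a), (forall a, u2 a = w21 a + w22 a),
        (forall a, v1 a = w11 a + w21 a) & (forall a, v2 a = w12 a + w22 a)].
Proof.
move=> Au1 Au2 Av1 Av2 uv.
have Aw := additive_meet Au1 Av1.
have wu a : meet u1 v1 a <= u1 a.
  apply: le_trans (meet_le Au1 Av1 (plus_zero a)) _.
  have := Av1.2 _ _ _ (plus_zero a); lra.
have wv a : meet u1 v1 a <= v1 a.
  have [_ _ swap _] := HE.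
  (* The exchange axiom supplies [d] with [d + a = a], and additivity forces [u1 d = 0]. *)
  have [d [_ [da _]]] := swap _ _ _ (plus_zero a).
  apply: le_trans (meet_le Au1 Av1 da) _.
  have := Au1.2 _ _ _ (plus_zero a); have := Au1.2 _ _ _ da; lra.
have w22 a : v1 a - meet u1 v1 a <= u2 a.
  rewrite lerBlDl -lerBlDr; apply: meet_ge => b c bca; rewrite lerBlDr.
  rewrite (Av1.2 _ _ _ bca) (Au2.2 _ _ _ bca).
  have := uv b; have := Av2.1 b; have := Au2.1 c; lra.
have Aw21 := additive_mapB Av1 Aw wv.
exists (meet u1 v1), (fun a => u1 a - meet u1 v1 a),
  (fun a => v1 a - meet u1 v1 a), (fun a => u2 a - (v1 a - meet u1 v1 a)).
split; first by split => //; exact: additive_mapB.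
split=> a; last by have := uv a; lra.
- by rewrite addrC subrK.
- by rewrite addrC subrK.
- by rewrite addrC subrK.
Qed.

(** * Finite decompositions and their common refinements *)

Fixpoint decomp w (ts : seq (E -> R)) : Prop :=
  if ts is t :: ts' then additive_map t /\
    exists2 w', decomp w' ts' & forall a, w a = t a + w' a
  else forall a, w a = 0.

Lemma decomp_additive w ts : decomp w ts -> additive_map w.
Proof.
elim: ts w => [|t ts IH] w /=.
  move=> w0; have -> : w = fun=> 0 by apply/funext.
  exact: additive_map0.
move=> [At [w' /IH Aw' ww']].
have -> : w = fun a => t a + w' a by apply/funext.
exact: additive_mapD.
Qed.

Lemma decomp1 w : additive_map w -> decomp w [:: w].
Proof. by move=> Aw; split=> //; exists (fun=> 0) => // a; rewrite addr0. Qed.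

Lemma decomp_cat u v w us vs : decomp u us -> decomp v vs ->
  (forall a, w a = u a + v a) -> decomp w (us ++ vs).
Proof.
elim: us u w => [|t us IH] u w /=.
  move=> u0 dv wv; have -> // : w = v.
  by apply/funext => a; rewrite wv u0 add0r.
move=> [At [u' du' uu']] dv wuv; split=> //.
exists (fun a => u' a + v a); first exact: (IH u').
by move=> a; rewrite wuv uu' addrA.
Qed.

Variable s0 : @state_set R E plus one.
Local Notation K := (state_pt s0).
Implicit Types f g : K -> R.

(* The default [s0] is harmless: it only ever appears multiplied by
   [u one = 0]. *)
Definition normalize u : K :=
  if pselect (state_set plus one (fun a => u a / u one)) is left p
  then SigSub (mem_set p) else s0.

Lemma normalizeE u a : additive_map u -> u one != 0 ->
  set_val (normalize u) a = u a / u one.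
Proof.
move=> [u0 uD] u1; rewrite /normalize; case: pselect => [p //|[]].
split=> [b|b c d bcd|].
- by rewrite divr_ge0.
- by rewrite (uD _ _ _ bcd) mulrDl.
- by rewrite divff.
Qed.

Lemma state_additive (x : K) : additive_map (set_val x : E -> R).
Proof. by case: (set_valP x). Qed.

Lemma state_one (x : K) : (set_val x : E -> R) one = 1.
Proof. by case: (set_valP x). Qed.

Lemma normalize_state (x : K) : normalize (set_val x : E -> R) = x.
Proof.
apply: val_inj; apply/funext => a.
rewrite [LHS](normalizeE a (state_additive x)) ?state_one ?oner_eq0//.
by rewrite divr1.
Qed.

(** The extension of [f] from states to the cone of additive maps, homogeneous of degree one. *)
Definition persp f u := u one * f (normalize u).

(** When [u one] and [v one] are positive, [normalize w] is the convex combination of [normalize u]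
    and [normalize v] with weights [u one / w one] and [v one / w one]; multiplying the convexity
    inequality by [w one] gives the claim. If one of the two values is zero, that map vanishes
    identically. *)
Lemma persp_subadd f u v w : convex_on f -> additive_map u -> additive_map v ->
  (forall a, w a = u a + v a) -> persp f w <= persp f u + persp f v.
Proof.
move=> cf Au Av wuv.
have [u1|u1] := eqVneq (u one) 0.
  rewrite (_ : w = v) ?lerDr /persp ?u1 ?mul0r//.
  by apply/funext => a; rewrite wuv (additive_map_one Au u1) add0r.
have [v1|v1] := eqVneq (v one) 0.
  rewrite (_ : w = u) ?lerDl /persp ?v1 ?mul0r//.
  by apply/funext => a; rewrite wuv (additive_map_one Av v1) addr0.
have u1p : 0 < u one by rewrite lt_neqAle eq_sym u1 Au.1.
have v1p : 0 < v one by rewrite lt_neqAle eq_sym v1 Av.1.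
have w1p : 0 < w one by rewrite wuv addr_gt0.
have Aw : additive_map w.
  have -> : w = fun a => u a + v a by apply/funext.
  exact: additive_mapD.
have w1 : w one != 0 by rewrite gt_eqF.
have t01 : 0 <= u one / w one <= 1.
  rewrite divr_ge0 ?(ltW u1p) ?(ltW w1p)//=.
  by rewrite ler_pdivrMr// mul1r wuv lerDl ltW.
have uvw : 1 - u one / w one = v one / w one.
  by rewrite -(divff w1) -mulrBl wuv [u one + v one]addrC addrK.
have nw a : set_val (normalize w) a = u one / w one * set_val (normalize u) a +
    (1 - u one / w one) * set_val (normalize v) a.
  rewrite uvw !normalizeE// wuv mulrDl; congr (_ + _).
    by rewrite [RHS]mulrC mulrA divfK.
  by rewrite [RHS]mulrC mulrA divfK.
have := cf _ _ _ _ t01 nw; rewrite uvw -(ler_pM2l w1p) /persp.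
have wK x : w one * x / w one = x by rewrite mulrAC divff// mul1r.
by rewrite mulrDr !mulrA !wK.
Qed.

(** The sum of the [c_i f (x_i)], where a term [t] has weight [t one] and state [normalize t]. *)
Definition value f ts : R := \sum_(t <- ts) persp f t.

Lemma le_value f g w ts : decomp w ts -> (forall x, f x <= g x) ->
  value f ts <= value g ts.
Proof.
move=> + fg; elim: ts w => [|t ts IH] w /=; first by rewrite /value !big_nil.
move=> [At [w' /IH le' _]]; rewrite /value !big_cons lerD// ler_wpM2l//.
exact: At.1.
Qed.

Lemma value_cst c w ts : decomp w ts -> value (fun=> c) ts = w one * c.
Proof.
elim: ts w => [|t ts IH] w /=; first by move=> ->; rewrite /value big_nil mul0r.
by move=> [_ [w' /IH vE ->]]; rewrite /value big_cons -/(value _ _) vE mulrDl.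
Qed.

Lemma valueD f g ts : value (fun x => f x + g x) ts = value f ts + value g ts.
Proof. by rewrite /value -big_split; apply: eq_bigr => t _; rewrite /persp mulrDr. Qed.

Lemma valueZ c f ts : value (fun x => c * f x) ts = c * value f ts.
Proof. by rewrite /value mulr_sumr; apply: eq_bigr => t _; rewrite /persp mulrCA. Qed.

(** Jensen's inequality for finite decompositions. *)
Lemma persp_le_value f w ts : convex_on f -> decomp w ts ->
  persp f w <= value f ts.
Proof.
move=> cf; elim: ts w => [|t ts IH] w /=.
  by move=> w0; rewrite /value big_nil /persp w0 mul0r.
move=> [At [w' dw' ww']]; rewrite /value big_cons.
apply: le_trans (persp_subadd cf At (decomp_additive dw') ww') _.
by rewrite lerD2l; exact: IH.
Qed.

(** Each term of [vs] is cut by [additive_refine] into a part for [u] and a part for [r], and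
    cutting a term can only increase its contribution. The cut is chosen before [f], so it serves
    all convex functions together. *)
Lemma decomp_split w u r vs : decomp w vs -> additive_map u -> additive_map r ->
  (forall a, u a + r a = w a) ->
  exists us rs, [/\ decomp u us, decomp r rs &
    forall f, convex_on f -> value f vs <= value f us + value f rs].
Proof.
elim: vs w u r => [|v vs IH] w u r /=.
  move=> w0 Au Ar ur; exists [::], [::]; split=> [a|a|f _].
  - by apply/eqP; rewrite eq_le Au.1 -(w0 a) -ur lerDl Ar.1.
  - by apply/eqP; rewrite eq_le Ar.1 -(w0 a) -ur lerDr Au.1.
  - by rewrite /value !big_nil addr0.
move=> [Av [w' dw' ww']] Au Ar ur.
have Aw' := decomp_additive dw'.
have urvw a : u a + r a = v a + w' a by rewrite ur.
have [w11 [w12 [w21 [w22 [[A11 A12 A21 A22] [uE rE vE wE]]]]]] :=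
  additive_refine Au Ar Av Aw' urvw.
have [us [rs [dus drs le']]] := IH _ _ _ dw' A12 A22 (fun a => esym (wE a)).
exists (w11 :: us), (w21 :: rs); split.
- by split=> //; exists w12.
- by split=> //; exists w22.
- move=> f cf; rewrite /value !big_cons addrACA; apply: lerD; last exact: le'.
  exact: persp_subadd.
Qed.

(** Splitting [vs] along the first term [u] and its remainder [w'] leaves two decompositions of
    [w'], to which the induction applies. *)
Lemma decomp_common w us vs : decomp w us -> decomp w vs ->
  exists2 ts, decomp w ts &
    forall f, convex_on f -> value f us <= value f ts /\ value f vs <= value f ts.
Proof.
elim: us w vs => [|u us IH] w vs /=.
  move=> w0 dv; exists vs => // f cf; split=> //.
  by apply: le_trans (persp_le_value cf dv); rewrite /value big_nil /persp w0 mul0r.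
move=> [Au [w' dw' ww']] dv.
have [ws [rs [dws drs le1]]] := decomp_split dv Au (decomp_additive dw')
  (fun a => esym (ww' a)).
have [ts dts le2] := IH _ _ dw' drs.
exists (ws ++ ts); first exact: decomp_cat dws dts ww'.
move=> f cf; have [le2u le2r] := le2 f cf.
rewrite /value big_cons big_cat/=; split.
  by apply: lerD => //; exact: persp_le_value.
by apply: le_trans (le1 f cf) _; rewrite lerD2l.
Qed.

(** * The envelope at a state *)

Definition bounded_fun f := exists M, forall x, `|f x| <= M.

Variable s : K.
Local Notation ds := (decomp (set_val s : E -> R)).

Definition env f : R := sup [set value f ts | ts in ds].

Lemma ds1 : ds [:: (set_val s : E -> R)].
Proof. exact/decomp1/state_additive. Qed.

Lemma value1 f : value f [:: (set_val s : E -> R)] = f s.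
Proof. by rewrite /value big_seq1 /persp state_one mul1r normalize_state. Qed.

Lemma value_le_env f ts : bounded_fun f -> ds ts -> value f ts <= env f.
Proof.
move=> [M fM] dts; apply: ub_le_sup; last by exists ts.
exists M => _ [us dus <-].
apply: le_trans (le_value dus (g := fun=> M) _) _.
  by move=> x; apply: le_trans (fM x); exact: ler_norm.
by rewrite (value_cst M dus) state_one mul1r.
Qed.

Lemma env_le f c : (forall ts, ds ts -> value f ts <= c) -> env f <= c.
Proof.
move=> fc; apply: ge_sup; last by move=> _ [ts dts <-]; exact: fc.
by exists (value f [:: (set_val s : E -> R)]), [:: (set_val s : E -> R)] => //; exact: ds1.
Qed.

Lemma le_env f g : bounded_fun g -> (forall x, f x <= g x) -> env f <= env g.
Proof.
move=> bg fg; apply: env_le => ts dts.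
exact: le_trans (le_value dts fg) (value_le_env bg dts).
Qed.

Lemma bounded_funD f g : bounded_fun f -> bounded_fun g -> bounded_fun (fun x => f x + g x).
Proof.
move=> [M fM] [N gN]; exists (M + N) => x.
by apply: le_trans (ler_normD _ _) _; exact: lerD.
Qed.

Lemma bounded_funZ c f : bounded_fun f -> bounded_fun (fun x => c * f x).
Proof.
by move=> [M fM]; exists (`|c| * M) => x; rewrite normrM ler_wpM2l.
Qed.

(** Subadditivity holds for any supremum of this kind. For the converse, near-optimal decompositions
    for [f] and for [g] are replaced by a common refinement, which is at least as good for both. *)
Lemma envD f g : convex_on f -> convex_on g -> bounded_fun f -> bounded_fun g ->
  env (fun x => f x + g x) = env f + env g.
Proof.
move=> cf cg bf bg; apply/eqP; rewrite eq_le; apply/andP; split.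
  by apply: env_le => ts dts; rewrite valueD lerD ?value_le_env.
rewrite -lerBrDr; apply: env_le => us dus.
rewrite lerBrDr -lerBrDl; apply: env_le => vs dvs; rewrite lerBrDl.
have [ts dts le2] := decomp_common dus dvs.
apply: (@le_trans _ _ (value f ts + value g ts)).
  by apply: lerD; [case: (le2 f cf)|case: (le2 g cg)].
by rewrite -valueD value_le_env//; exact: bounded_funD.
Qed.

Lemma envZ c f : bounded_fun f -> 0 <= c -> env (fun x => c * f x) = c * env f.
Proof.
move=> + c0; have envZ_le d g : 0 <= d -> bounded_fun g ->
    env (fun x => d * g x) <= d * env g.
  move=> d0 bg; apply: env_le => ts dts.
  by rewrite valueZ ler_wpM2l// value_le_env.
move=> bf; apply/eqP; rewrite eq_le envZ_le//=.
have [->|cN0] := eqVneq c 0.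
  rewrite mul0r; apply: le_trans (value_le_env _ ds1); last exact: bounded_funZ.
  by rewrite value1 mul0r.
have {}c0 : 0 < c by rewrite lt_neqAle eq_sym cN0.
(* The converse inequality is [envZ_le] applied to [c^-1] and the function [c * f]. *)
rewrite -ler_pdivlMl//; apply: le_trans (envZ_le _ _ _ (bounded_funZ c bf)).
  by apply: le_env => // [|x]; [exact/bounded_funZ/bounded_funZ|rewrite mulKf// gt_eqF].
by rewrite invr_ge0 ltW.
Qed.

(** Jensen's inequality for both [f] and [-f] gives every decomposition of [s] the same value
    [f s]. *)
Lemma env_affine f : convex_on f -> convex_on (fun x => - f x) -> bounded_fun f ->
  env f = f s.
Proof.
move=> cf cnf bf; apply/eqP; rewrite eq_le; apply/andP; split.
  apply: env_le => ts dts; have := persp_le_value cnf dts.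
  rewrite -value1 {1}/persp state_one mul1r normalize_state.
  rewrite (_ : (fun x => - f x) = fun x => (-1) * f x).
    by rewrite valueZ mulN1r lerN2 value1.
  by apply/funext => x; rewrite mulN1r.
by rewrite -value1 value_le_env//; exact: ds1.
Qed.

End AdditiveMaps.

(** * The state space and its measures *)

Lemma ptws_cvgP (R : realType) (E : Type) (F : set_system {ptws E -> R})
    (p : {ptws E -> R}) : Filter F ->
  (forall a, (fun g : {ptws E -> R} => g a) @ F --> p a) -> F --> p.
Proof.
move=> FF H; apply/cvg_sup => a A [V [[W oW <-] Wp] WA].
apply: (filterS WA); apply: (H a).
by apply: open_nbhs_nbhs; split.
Qed.

Lemma ptws_ev_continuous (R : realType) (E : Type) (a : E) :
  continuous (fun g : {ptws E -> R} => g a).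
Proof.
move=> p; have /cvg_sup/(_ a) pa : p --> p by exact: cvg_id.
move=> A nA; apply: pa.
exact: (@initial_continuous _ _ (fun g : {ptws E -> R} => g a) p A nA).
Qed.

(** * Compactness and basic neighbourhoods of the state space *)

Section StateSpace.
Variables (R : realType) (E : Type) (plus : E -> E -> option E) (zero one : E).
Hypotheses (HE : pseudo_effect_algebra plus zero one).
Variable s0 : @state_set R E plus one.
Local Notation K := (state_pt s0).
Local Notation ev a := (fun x : K => (set_val x : E -> R) a).

Lemma ev_continuous a : continuous (ev a).
Proof.
move=> x A nA.
exact: (@initial_continuous (state_set plus one) {ptws E -> R} set_val x _
  (@ptws_ev_continuous R E a (set_val x) A nA)).
Qed.

Lemma state_cvg (F : set_system K) (x : K) : Filter F ->
  (forall a, ev a @ F --> (set_val x : E -> R) a) -> F --> x.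
Proof.
move=> FF H A [V [[W oW <-] Wx] WA]; apply: (filterS WA).
have := @ptws_cvgP R E (set_val @ F) (set_val x) _ H.
by apply; apply: open_nbhs_nbhs; split.
Qed.

Lemma ev_le1 (x : K) a : (set_val x : E -> R) a <= 1.
Proof.
have [_ compl _ _] := HE; have [[d [ad _]] _] := compl a.
have [x0 xD x1] := set_valP x.
by rewrite -x1 (xD _ _ _ ad) lerDl.
Qed.

Lemma ev_ge0 (x : K) a : 0 <= (set_val x : E -> R) a.
Proof. by case: (set_valP x) => + _ _; exact. Qed.

(** Along an ultrafilter every evaluation converges in the unit interval, and the pointwise limit
    inherits the equations defining a state. *)
Lemma state_compact : compact [set: K].
Proof.
rewrite compact_ultra => F FU _.
have PF : ProperFilter F by exact: ultra_proper.
have /choice[y yP] a : exists y : R, `[0, 1]%classic y /\ ev a @ F --> y.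
  have [|y [y01 yF]] := @segment_compact R 0 1 (ev a @ F) _.
    apply: (@filterS _ F _ setT); last exact: filterT.
    by move=> x _ /=; rewrite in_itv/= ev_ge0 ev_le1.
  exists y; split=> // A nA.
  have [//|FA] := in_ultra_setVsetC (ev a @^-1` A) FU.
  by have [|z []] := yF (~` A) A _ nA.
have y01 a := (yP a).1; have yF a := (yP a).2.
have sy : state_set plus one y.
  split.
  - by move=> a; have := y01 a; rewrite /= in_itv/= => /andP[].
  - move=> a b c abc.
    apply: (@cvg_unique R^o (@norm_hausdorff R R^o) (ev c @ F) _); first exact: yF.
    have -> : ev c = (fun x => ev a x + ev b x).
      by apply/funext => x; have [_ xD _] := set_valP x; exact: xD.
    by apply: (@cvgD R R^o); exact: yF.
  - apply: (@cvg_unique R^o (@norm_hausdorff R R^o) (ev one @ F) _); first exact: yF.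
    have -> : ev one = (fun=> 1).
      by apply/funext => x; have [_ _ x1] := set_valP x.
    exact: cvg_cst.
exists (SigSub (mem_set sy) : K); split => //.
exact: state_cvg.
Qed.

(** The nonstrict inequality is preserved by averaging, so barycenters of measures on such a set
    remain in it. *)
Definition near_on (l : seq E) (e : R) (x y : K) :=
  all (fun a => `|(set_val x : E -> R) a - (set_val y : E -> R) a| <= e) l.

Lemma nbhs_near_on l e x : 0 < e -> nbhs x (near_on l e x).
Proof.
move=> e0; elim: l => [|a l IH]; first exact: (filterS _ filterT).
have /cvgrPdist_le/(_ e e0) xa := @ev_continuous a x.
by apply: filterS2 IH xa => y xy ya; rewrite /near_on/= ya.
Qed.

(** The sets containing some [near_on l e x] form a filter along which every evaluation converges to
    its value at [x]; hence this filter converges to [x]. *)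
Lemma nbhs_state_basis (x : K) A : nbhs x A ->
  exists l e, 0 < e /\ near_on l e x `<=` A.
Proof.
pose G : set_system K := [set A | exists l e, 0 < e /\ near_on l e x `<=` A].
have FG : Filter G.
  split.
  - by exists [::], 1.
  - move=> B C [l [e [e0 lB]]] [l' [e' [e'0 lC]]].
    exists (l ++ l'), (Num.min e e'); split; first by rewrite lt_min e0.
    move=> y; rewrite /near_on all_cat => /andP[hl hl']; split.
      by apply: lB; apply: sub_all hl => a; rewrite le_min => /andP[].
    by apply: lC; apply: sub_all hl' => a; rewrite le_min => /andP[].
  - by move=> B C BC [l [e [e0 lB]]]; exists l, e; split=> // y /lB/BC.
apply: (@state_cvg G x) => a; apply/cvgrPdist_le => e e0.
exists [:: a], e; split=> // y; rewrite /near_on/= andbT.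
exact.
Qed.

End StateSpace.

(** * Approximating integrals by finite sums over barycenters *)

Section Barycenter.
Variables (R : realType) (E : Type) (plus : E -> E -> option E) (zero one : E).
Hypotheses (HE : pseudo_effect_algebra plus zero one).
Variable s0 : @state_set R E plus one.
Local Notation K := (state_pt s0).
Local Notation BK := (g_sigma_algebraType (@open K)).
Local Notation ev a := (fun x : K => (set_val x : E -> R) a).
Variable mu : {measure set BK -> \bar R}.
Hypothesis mufin : (mu setT < +oo)%E.

Let cK : compact [set: K] := state_compact HE (s0 := s0).

(** The barycenter of the restriction of [mu] to [B], multiplied by the mass of [B]; unnormalized,
    it is additive in [B]. *)
Definition restr_mean (B : set BK) (a : E) : R := \int[mu]_(x in B) ev a x.

Lemma restr_mean_additive B : measurable B -> additive_map plus (restr_mean B).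
Proof.
move=> mB; split=> [a|a b c abc].
  by apply: Rintegral_ge0 => x _; exact: ev_ge0.
rewrite /restr_mean -RintegralD//; first last.
- by apply: continuous_integrable => //; exact: ev_continuous.
- by apply: continuous_integrable => //; exact: ev_continuous.
by apply: eq_Rintegral => x _; have [_ xD _] := set_valP x; exact: xD.
Qed.

Lemma restr_mean_one B : measurable B -> restr_mean B one = fine (mu B).
Proof.
move=> mB; rewrite -[RHS]mul1r -Rintegral_cst//.
by apply: eq_Rintegral => x _; have [_ _ x1] := set_valP x.
Qed.

Lemma Rintegral_le_cst (B : set BK) (f : K -> R) c : measurable B ->
  continuous f -> (forall x, B x -> f x <= c) ->
  \int[mu]_(x in B) f x <= c * fine (mu B).
Proof.
move=> mB cf fc; rewrite -Rintegral_cst//; apply: le_Rintegral => //.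
  exact: continuous_integrable.
by apply: continuous_integrable => //; exact: cst_continuous.
Qed.

Lemma Rintegral_ge_cst (B : set BK) (f : K -> R) c : measurable B ->
  continuous f -> (forall x, B x -> c <= f x) ->
  c * fine (mu B) <= \int[mu]_(x in B) f x.
Proof.
move=> mB cf fc; rewrite -Rintegral_cst//; apply: le_Rintegral => //.
  by apply: continuous_integrable => //; exact: cst_continuous.
exact: continuous_integrable.
Qed.

Lemma Rintegral_split (B U : set BK) (f : K -> R) : measurable B ->
  measurable U -> continuous f ->
  \int[mu]_(x in B) f x = \int[mu]_(x in B `&` U) f x + \int[mu]_(x in B `\` U) f x.
Proof.
move=> mB mU cf; rewrite -Rintegral_setU ?setUIDK//.
- exact: measurableI.
- exact: measurableD.
- exact: continuous_integrable.
- by apply/disj_set2P/seteqP; split=> // x [[_ Ux] [_ nUx]].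
Qed.

Definition small_on (f : K -> R) (e : R) (B : set BK) :=
  exists2 ts, decomp plus (restr_mean B) ts &
    \int[mu]_(x in B) f x <= value f ts + e * fine (mu B).

(** Choose [U] inside a basic neighbourhood of [x] on which [f] varies by at most [e / 2] from
    [f x]. The barycenter of [B] stays in that neighbourhood, so a single term is enough: [f] at the
    barycenter is at least [f x - e / 2], and [f] on [B] is at most [f x + e / 2]. *)
Lemma small_on_near (f : K -> R) e (x : K) : continuous f -> 0 < e ->
  exists2 U : set K, open U /\ U x &
    forall B : set BK, measurable B -> B `<=` U -> small_on f e B.
Proof.
move=> cf e0; have e20 : 0 < e / 2 by rewrite divr_gt0.
have nf : nbhs x [set y | `|f x - f y| <= e / 2].
  by have /cvgrPdist_le := cf x; apply.
have [l [r [r0 lf]]] := nbhs_state_basis nf.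
have := nbhs_near_on l x r0; rewrite nbhsE => -[U [oU Ux] Ul].
exists U => // B mB BU; exists [:: restr_mean B].
  exact/decomp1/restr_mean_additive.
rewrite /value big_seq1 /persp restr_mean_one//.
have mB0 : 0 <= fine (mu B) by rewrite fine_ge0.
have fB : \int[mu]_(y in B) f y <= (f x + e / 2) * fine (mu B).
  apply: Rintegral_le_cst => // y /BU/Ul/lf /=.
  by rewrite ler_distlC => /andP[_]; rewrite addrC; lra.
(* A null set [B] has no barycenter, but both sides vanish. *)
apply: (le_trans fB); have [->|muB] := eqVneq (fine (mu B)) 0.
  by rewrite !mulr0 mul0r addr0.
have muB0 : 0 < fine (mu B) by rewrite lt_neqAle eq_sym muB.
have : near_on l r x (normalize s0 (restr_mean B)).
  have lr : near_on l r x `<=` near_on l r x by [].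
  have {}Ul y : B y -> near_on l r x y by move=> /BU/Ul.
  rewrite /near_on; elim: l {lf lr} Ul => //= a l IH Ul.
  rewrite IH ?andbT; last by move=> y /Ul/andP[].
  rewrite normalizeE; last 2 first.
  - exact: restr_mean_additive.
  - by rewrite restr_mean_one.
  rewrite restr_mean_one// ler_distlC; apply/andP; split.
    rewrite ler_pdivlMr//; apply: Rintegral_ge_cst => //; first exact: ev_continuous.
    by move=> y /Ul/andP[+ _]; rewrite ler_distlC => /andP[].
  rewrite ler_pdivrMr//; apply: Rintegral_le_cst => //; first exact: ev_continuous.
  by move=> y /Ul/andP[+ _]; rewrite ler_distlC => /andP[].
move=> /lf /=; rewrite ler_distlC => /andP[fl _].
apply: (@le_trans _ _ ((f (normalize s0 (restr_mean B)) + e) * fine (mu B))).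
  by rewrite ler_pM2r//; lra.
by rewrite mulrDl [X in X + _]mulrC.
Qed.

Lemma small_onT (f : K -> R) e : continuous f -> 0 < e -> small_on f e setT.
Proof.
move=> cf e0.
(* The property is required of all measurable subsets of [U], so that a union can be cut into the
   disjoint pieces inside and outside [U1]. *)
have [U [mU UT] sU] : exists2 U : set BK, measurable U /\ [set: K] `<=` U &
    forall B : set BK, measurable B -> B `<=` U -> small_on f e B.
  apply: (compact_ind (P := fun A => exists2 U : set BK, measurable U /\ A `<=` U &
    forall B : set BK, measurable B -> B `<=` U -> small_on f e B) cK).
  - exists set0 => [|B _]; first by split; first exact: measurable0.
    rewrite subset0 => ->.
    exists [::].
      by move=> a; rewrite /restr_mean Rintegral_set0.
    by rewrite Rintegral_set0 /value big_nil measure0 mulr0 addr0.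
  - move=> A B AB [U [mU BU] sU]; exists U => //; split=> //.
    exact: subset_trans BU.
  - move=> A1 A2 [U1 [mU1 AU1] sU1] [U2 [mU2 AU2] sU2].
    exists (U1 `|` U2); first by split; [exact: measurableU|exact: setUSS].
    move=> B mB BU.
    have mB1 : measurable (B `&` U1) by exact: measurableI.
    have mB2 : measurable (B `\` U1) by exact: measurableD.
    have [|ts1 d1 le1] := sU1 _ mB1; first exact: subIsetr.
    have [|ts2 d2 le2] := sU2 _ mB2; first by move=> x [/BU[]].
    exists (ts1 ++ ts2).
      apply: (decomp_cat d1 d2) => a; apply: Rintegral_split => //.
      exact: ev_continuous.
    rewrite (Rintegral_split mB mU1 cf) /value big_cat/=.
    have -> : fine (mu B) = fine (mu (B `&` U1)) + fine (mu (B `\` U1)).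
      by rewrite -!restr_mean_one//; apply: Rintegral_split => //; exact: ev_continuous.
    by rewrite mulrDr addrACA; exact: lerD.
  - move=> x _; have [U [oU Ux] sU] := small_on_near x cf e0.
    exists U; first exact: open_nbhs_nbhs.
    by exists U => //; split=> //; exact: borel_open.
by apply: sU => // x _; exact: UT.
Qed.

(** When [mu] has barycenter [s], the lists given by [small_onT] decompose [s] itself, so their
    values are bounded by the envelope. *)
Lemma Rintegral_le_env (s : K) (f : K -> R) : continuous f ->
  (forall a, \int[mu]_x ev a x = (set_val s : E -> R) a) ->
  \int[mu]_x f x <= env s f.
Proof.
move=> cf bar.
apply: (@ler_addeps _ _ _ 1) => // e e0.
have [ts dts le_ts] := small_onT cf e0.
have ms : restr_mean setT = (set_val s : E -> R) by apply/funext.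
apply: (le_trans le_ts); rewrite -restr_mean_one// ms state_one lerD2r.
apply: value_le_env; last by rewrite -ms.
by have [M _ fM] := continuous_bounded cK cf; exists M.
Qed.

End Barycenter.

(** * Differences of convex continuous functions and the envelope functional *)

Section ConvexFunctions.
Variables (R : realType) (E : Type) (plus : E -> E -> option E) (zero one : E).
Variable s0 : @state_set R E plus one.
Local Notation K := (state_pt s0).
Local Notation ev a := (fun x : K => (set_val x : E -> R) a).
Implicit Types f g : K -> R.

Lemma Con_D f g : Con f -> Con g -> Con (fun x => f x + g x).
Proof.
move=> [cf xf] [cg xg]; split=> [x|x y z t t01 xyz].
  by apply: (@continuousD R R^o); [exact: cf|exact: cg].
have := xf _ _ _ _ t01 xyz; have := xg _ _ _ _ t01 xyz; lra.
Qed.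

Lemma Con_Z c f : 0 <= c -> Con f -> Con (fun x => c * f x).
Proof.
move=> c0 [cf xf]; split=> [x|x y z t t01 xyz].
  by apply: continuousM; [exact: cst_continuous|exact: cf].
by rewrite mulrCA [(1 - t) * _]mulrCA -mulrDr ler_wpM2l//; exact: xf.
Qed.

Lemma Con_max f g : Con f -> Con g -> Con (fun x => Num.max (f x) (g x)).
Proof.
move=> [cf xf] [cg xg]; split=> [|x y z t t01 xyz].
  exact: max_fun_continuous.
have /andP[t0 t1] := t01.
rewrite ge_max (le_trans (xf _ _ _ _ t01 xyz)) ?(le_trans (xg _ _ _ _ t01 xyz))//;
  by apply: lerD; rewrite ler_wpM2l ?subr_ge0// le_max lexx ?orbT.
Qed.

Lemma Aff_Con f : Aff f -> Con f.
Proof. by move=> [cf af]; split=> // x y z t t01 xyz; rewrite (af _ _ _ _ t01 xyz). Qed.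

Lemma Aff_cst c : @Aff _ _ plus one s0 (fun=> c).
Proof.
by split=> [|x y z t _ _]; [exact: cst_continuous|rewrite -mulrDl subrKC mul1r].
Qed.

Lemma Con_cst c : @Con _ _ plus one s0 (fun=> c).
Proof. exact/Aff_Con/Aff_cst. Qed.

Lemma Aff_N f : Aff f -> Aff (fun x => - f x).
Proof.
move=> [cf af]; split=> [x|x y z t t01 xyz].
  by apply: (@continuousN R R^o); exact: cf.
by rewrite (af _ _ _ _ t01 xyz) opprD !mulrN.
Qed.

Lemma Aff_ev a : Aff (ev a).
Proof. by split=> [|x y z t _ ->]//; exact: ev_continuous. Qed.

Definition DCon : set (K -> R) :=
  [set h | exists f g, [/\ Con f, Con g & h = fun x => f x - g x]].

Lemma Con_DCon f : Con f -> DCon f.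
Proof.
move=> cf; exists f, (fun=> 0); split=> //; first exact: Con_cst.
by apply/funext => x; rewrite subr0.
Qed.

Lemma DCon_lattice : vector_lattice DCon.
Proof.
split.
- exact/Con_DCon/Con_cst.
- move=> _ _ [f [g [cf cg ->]]] [f' [g' [cf' cg' ->]]].
  exists (fun x => f x + f' x), (fun x => g x + g' x).
  by split; [exact: Con_D..|apply/funext => x; rewrite opprD addrACA].
- move=> c _ [f [g [cf cg ->]]]; have [c0|/ltW c0] := leP 0 c.
    exists (fun x => c * f x), (fun x => c * g x).
    by split; [exact: Con_Z..|apply/funext => x; rewrite mulrBr].
  exists (fun x => - c * g x), (fun x => - c * f x).
  split; [by apply: Con_Z; rewrite ?oppr_ge0..|apply/funext => x; lra].
- move=> _ [f [g [cf cg ->]]].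
  (* [|f - g|] equals twice the maximum of [f] and [g], minus [f + g]. *)
  exists (fun x => 2 * Num.max (f x) (g x)), (fun x => f x + g x).
  split; [by apply: Con_Z => //; exact: Con_max|exact: Con_D|].
  by apply/funext => x; rewrite maxr_absE; lra.
Qed.

Lemma DCon_continuous h : DCon h -> continuous h.
Proof.
move=> [f [g [[cf _] [cg _] ->]]] x.
by apply: (@continuousB R R^o); [exact: cf|exact: cg].
Qed.

Lemma DCon_separating (x y : K) : x <> y -> exists2 f, DCon f & f x <> f y.
Proof.
move=> xy; have [a xya] : exists a, (set_val x : E -> R) a <> (set_val y : E -> R) a.
  apply: contrapT => nxy; apply: xy; apply: val_inj; apply/funext => a.
  by apply: contrapT => xya; apply: nxy; exists a.
by exists (ev a) => //; exact/Con_DCon/Aff_Con/Aff_ev.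
Qed.

Hypotheses (HE : pseudo_effect_algebra plus zero one) (HRDP : RDP plus).
Variable s : K.

Lemma Con_bounded f : Con f -> bounded_fun f.
Proof.
move=> [cf _]; have [M _ fM] := continuous_bounded (state_compact HE (s0:=s0)) cf.
by exists M.
Qed.

Lemma env_ConD f g : Con f -> Con g ->
  env s (fun x => f x + g x) = env s f + env s g.
Proof.
move=> cf cg; apply: (envD HE HRDP); [by case: cf|by case: cg|exact: Con_bounded..].
Qed.

(** A choice of value over all representations of [h], with default [0] outside [DCon]; [env_diffE]
    shows that all representations agree. *)
Definition env_diff (h : K -> R) : R := xget 0 [set r | exists f g,
  [/\ Con f, Con g, h = (fun x => f x - g x) & r = env s f - env s g]].

Lemma env_diffE f g : Con f -> Con g ->
  env_diff (fun x => f x - g x) = env s f - env s g.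
Proof.
move=> cf cg; apply: xget_unique; first by exists f, g.
move=> _ [f' [g' [cf' cg' fg ->]]].
(* From [f - g = f' - g'] follows [f + g' = f' + g], and the envelope is additive on these sums. *)
apply/eqP; rewrite subr_eq addrAC eq_sym subr_eq; apply/eqP.
rewrite -!env_ConD//.
congr env; apply/funext => x; have := congr1 (@^~ x) fg => /=; lra.
Qed.

Lemma env_diff_Con f : Con f -> env_diff f = env s f.
Proof.
move=> cf; have [_ x0] := Con_cst 0; have b0 := Con_bounded (Con_cst 0).
have env0 : env s (fun=> 0) = 0.
  by apply: (env_affine HE) => //; rewrite oppr0.
rewrite -[RHS]subr0 -env0 -env_diffE//; last exact: Con_cst.
by congr env_diff; apply/funext => x; rewrite subr0.
Qed.

Lemma env_diff_linear : positive_linear DCon env_diff.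
Proof.
split.
- move=> _ _ [f [g [cf cg ->]]] [f' [g' [cf' cg' ->]]].
  have -> : (fun x => f x - g x + (f' x - g' x)) =
      fun x => (f x + f' x) - (g x + g' x).
    by apply/funext => x; rewrite opprD addrACA.
  rewrite !env_diffE//; [|exact: Con_D..].
  by rewrite !env_ConD// opprD addrACA.
- have pos c f g : 0 <= c -> Con f -> Con g ->
      env_diff (fun x => c * (f x - g x)) = c * env_diff (fun x => f x - g x).
    move=> c0 cf cg.
    have -> : (fun x => c * (f x - g x)) = fun x => c * f x - c * g x.
      by apply/funext => x; rewrite mulrBr.
    rewrite !env_diffE//; [|exact: Con_Z..].
    by rewrite !(envZ s) ?mulrBr//; exact: Con_bounded.
  move=> c _ [f [g [cf cg ->]]]; have [c0|/ltW c0] := leP 0 c; first exact: pos.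
  have -> : (fun x => c * (f x - g x)) = fun x => - c * (g x - f x).
    by apply/funext => x; rewrite mulNr -mulrN opprB.
  by rewrite pos ?oppr_ge0// !env_diffE// mulNr -mulrN opprB.
- move=> _ [f [g [cf cg ->]]] fg; rewrite env_diffE// subr_ge0.
  apply: le_env; first exact: Con_bounded.
  by move=> x; rewrite -subr_ge0.
Qed.

End ConvexFunctions.

(** * Existence, maximality and uniqueness of the representing measure *)

Unset Implicit Arguments.
Set Strict Implicit.

Theorem theorem5p5 (R : realType) (E : Type) (plus : E -> E -> option E)
  (zero one : E)
  (HE : pseudo_effect_algebra plus zero one) (HRDP : RDP plus)
  (Hne : @state_set R E plus one !=set0)
  (s : @state_set R E plus one) :
  exists mu : {measure set (borel_states s) -> \bar R},
    [/\ regular_measure mu,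
        mu setT = 1%E,
        choquet_maximal mu,
        meas_equiv mu (@dirac _ (borel_states s) s R)
      & forall a : E,
          ((set_val s) a)%:E = (\int[mu]_x ((set_val x) a)%:E)%E]
    /\
    forall nu : {measure set (borel_states s) -> \bar R},
      regular_measure nu -> nu setT = 1%E -> choquet_maximal nu ->
      meas_equiv nu (@dirac _ (borel_states s) s R) ->
      forall A : set (borel_states s), measurable A -> nu A = mu A.
Proof.
(* [s] is both the base point of the state space type and, as [sK], the state at which envelopes are
   taken. *)
pose sK : state_pt s := s.
have cK : compact [set: state_pt s] := state_compact HE (s0 := s).
have latV := @DCon_lattice R E plus one s.
have ctsV := @DCon_continuous R E plus one s.
have sepV := @DCon_separating R E plus one s.
have [mu rmu muE] := riesz_representation cK latV ctsV sepV
  (env_diff_linear HE HRDP sK).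
have mufin := rmu.1.
have integralE (la : {measure set (borel_states s) -> \bar R}) (f : state_pt s -> R) :
    (la setT < +oo)%E -> continuous f ->
    (\int[la]_x (f x)%:E)%E = (\int[la]_x f x)%:E.
  by move=> lafin cf; exact: (EFin_Rintegral cK).
have muCon (f : state_pt s -> R) : @Con _ _ plus one s f -> \int[mu]_x f x = env sK f.
  move=> cf; rewrite -(env_diff_Con HE HRDP sK cf); apply: EFin_inj.
  by rewrite -muE ?integralE//; [case: cf|exact: Con_DCon].
have muAff (f : state_pt s -> R) : @Aff _ _ plus one s f -> \int[mu]_x f x = f sK.
  move=> af; rewrite muCon ?(env_affine HE)//.
  - by case: (Aff_Con af).
  - by case: (Aff_Con (Aff_N af)).
  - exact/(Con_bounded HE)/Aff_Con.
  - exact: Aff_Con.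
have diracE (f : state_pt s -> R) : @Aff _ _ plus one s f ->
    (\int[@dirac _ (borel_states s) s R]_x (f x)%:E)%E = (f sK)%:E.
  move=> [cf _]; rewrite integral_dirac//; last first.
    by apply/measurable_EFinP; exact: continuous_borel.
  by rewrite diracT mul1e.
have muT : mu setT = 1%E.
  have mu_fin_num : mu setT \is a fin_num by rewrite ge0_fin_numE.
  rewrite -[LHS]fineK//; congr EFin.
  by have := muAff _ (Aff_cst s 1); rewrite Rintegral_cst// mul1r.
have integrable_Con (la : {measure set (borel_states s) -> \bar R})
    (f : state_pt s -> R) : (la setT < +oo)%E -> @Con _ _ plus one s f ->
    la.-integrable setT (EFin \o f).
  by move=> lafin [cf _]; exact: (continuous_integrable cK).
(* Integrals of convex functions determine those on [DCon], hence the regular measure. *)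
have eq_on_Con (la : {measure set (borel_states s) -> \bar R}) :
    regular_measure la ->
    (forall f : state_pt s -> R, @Con _ _ plus one s f ->
       \int[la]_x f x = \int[mu]_x f x) ->
    forall A : set (borel_states s), measurable A -> la A = mu A.
  move=> rla laCon; apply: (regular_unique cK latV ctsV sepV) => //.
  move=> _ [f [g [cf cg ->]]]; have lafin := rla.1.
  by rewrite !RintegralB ?laCon//; exact: integrable_Con.
(* Any finite measure with the same affine integrals as the Dirac measure at [s] has barycenter [s],
   so its integrals of convex functions are bounded by the envelope, that is, by those of [mu]. *)
have le_mu (la : {measure set (borel_states s) -> \bar R}) : (la setT < +oo)%E ->
    (forall f : state_pt s -> R, @Aff _ _ plus one s f ->
       \int[la]_x f x = f sK) ->
    forall f : state_pt s -> R, @Con _ _ plus one s f ->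
      \int[la]_x f x <= \int[mu]_x f x.
  move=> lafin laA f cf; rewrite muCon//.
  apply: (Rintegral_le_env HE lafin); first by case: cf.
  by move=> a; apply: laA; exact: Aff_ev.
have max_mu : choquet_maximal mu.
  split=> // la rla mula; have lafin := rla.1.
  have mule (f : state_pt s -> R) : @Con _ _ plus one s f ->
      \int[mu]_x f x <= \int[la]_x f x.
    by move=> cf; have := mula f cf; rewrite !integralE ?lee_fin//; case: cf.
  apply: eq_on_Con => // f cf; apply/eqP; rewrite eq_le mule// andbT.
  (* A measure [la] above [mu] agrees with it on an affine [g], because both [g] and [-g] are
     convex; hence [la] also represents [s], and [le_mu] gives the reverse inequality. *)
  apply: le_mu => // g ag; rewrite -muAff//.
  apply/eqP; rewrite eq_le mule ?andbT; last exact: Aff_Con.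
  have := mule _ (Aff_Con (Aff_N ag)).
  have N1 (m : {measure set (borel_states s) -> \bar R}) : (m setT < +oo)%E ->
      \int[m]_x (- g x) = - \int[m]_x g x.
    move=> mfin; rewrite -mulN1r -RintegralZl//.
      by apply: eq_Rintegral => x _; rewrite mulN1r.
    exact/integrable_Con/Aff_Con.
  by rewrite !N1// lerN2.
exists mu; split; first split=> //.
- by move=> f af; rewrite integralE ?muAff ?diracE//; case: af.
- move=> a; rewrite integralE//; last exact: ev_continuous.
  by rewrite muAff//; exact: Aff_ev.
- move=> nu rnu nuT [_ maxnu] nudirac A mA.
  have nufin : (nu setT < +oo)%E by rewrite nuT ltry.
  (* Since [nu] represents [s], it lies below [mu] in the Choquet order, and its maximality forces
     equality. *)
  apply/esym/maxnu => // f cf.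
  rewrite !integralE//; [|by case: cf..]; rewrite lee_fin.
  apply: le_mu => // g ag; apply: EFin_inj.
  by rewrite -integralE ?nudirac ?diracE//; case: ag.
Qed.
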